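(* For every constant $\epsilon\in(0,1)$ there exists an algorithm for the submodular random order streaming problem that outputs a set whose value is (in expectation) at least $\left(1-\frac{1}{e}-\epsilon-O(\frac{1}{k})\right)\mathrm{OPT}$, while using a memory buffer of size at most $\eta_\epsilon(k)=O(k)$ (with $\eta_\epsilon(k)=O(2^{\mathrm{poly}(1/\epsilon)}k)$). Moreover, the number of evaluations of the objective function per item, amortized over the $n$ items, is $O(1+\frac{k^2}{n})$.
   Context: Submodular random order streaming problem: a fixed but unknown set $\mathcal U$ of $n$ items arrives one at a time in a uniformly random order. $f:2^{\mathcal U}\to\mathbb{R}$ is a monotone submodular function accessible through a value oracle. The algorithm maintains a memory buffer of bounded size (items stored in the buffer may later be discarded and replaced by newly arriving items) and at the end outputs a set $S\subseteq\mathcal U$ with $|S|\le k$; the goal is to maximize $f(S)$. $\mathrm{OPT}=\max_{S\subseteq\mathcal U,|S|\le k}f(S)$. Asymptotic notation is with respect to $k$ and $n$.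
   Formalization: The objective f is additionally assumed nonnegative (f(∅) ≥ 0); without this the claim fails, e.g. for f ≡ −1 every output has value −1, which is below (1−1/e−ε−O(1/k))·OPT for large k. *)

(* Defs.v *)
From HB Require Import structures.
From mathcomp Require Import all_boot all_order all_algebra.
From mathcomp Require Import all_fingroup reals sequences exp.
Set Implicit Arguments. Unset Strict Implicit. Unset Printing Implicit Defensive.
Import Order.TTheory GRing.Theory Num.Theory.
Local Open Scope ring_scope.

(* Value-oracle programs.  A program may adaptively ask value-oracle
   queries and finally returns a result.  A query is a bit mask [m]
   selecting a subset of the items currently available to the algorithm
   (the buffer, plus the item just arrived during a processing step);
   the environment answers with the value of f on that subset.        *)
Inductive prog (R A : Type) : Type :=
| Ret : A -> prog R A
| Ask : seq bool -> (R -> prog R A) -> prog R A.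
Arguments Ret {R A}.
Arguments Ask {R A}.

Fixpoint run (R A : Type) (ans : seq bool -> R) (p : prog R A) : A * nat :=
  match p with
  | Ret a => (a, 0%N)
  | Ask m k => let r := run ans (k (ans m)) in (r.1, r.2.+1)
  end.

(* A streaming algorithm.  Besides its buffer of stored items it keeps an
   auxiliary state of arbitrary type, but it never sees the items
   themselves: it only sees oracle answers.
   - [init n k]  : initial state, knowing the stream length n and k;
   - [step s]    : on arrival of an item, with current state s, query the
                   oracle on subsets of (buffer ++ [:: new item]) and return
                   the new state and a mask of (buffer ++ [:: new item])
                   describing the items kept in the new buffer;
   - [finish s]  : at the end, query subsets of the buffer and return a
                   mask of the buffer selecting the output set.            *)
Record algorithm (R : Type) := Algorithm {
  alg_state : Type;
  alg_init : nat -> nat -> alg_state;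
  alg_step : alg_state -> prog R (alg_state * seq bool);
  alg_finish : alg_state -> prog R (seq bool)
}.

Section Semantics.
Variables (R : Type) (U : finType) (A : algorithm R) (f : {set U} -> R).

Definition oracle (avail : seq U) (m : seq bool) : R := f [set y in mask m avail].

Fixpoint process (st : alg_state A) (buf : seq U) (s : seq U)
  : (alg_state A * seq U) * (nat * nat) :=
  match s with
  | [::] => ((st, buf), (0%N, size buf))
  | x :: s' =>
      let r := run (oracle (rcons buf x)) (@alg_step _ A st) in
      let buf' := mask r.1.2 (rcons buf x) in
      let rest := process r.1.1 buf' s' in
      (rest.1, ((r.2 + rest.2.1)%N, maxn (size buf) rest.2.2))
  end.

Definition outcome (k : nat) (s : seq U) : {set U} * nat * nat :=
  let p := process (alg_init A (size s) k) [::] s in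
  let fin := run (oracle p.1.2) (@alg_finish _ A p.1.1) in
  ([set y in mask fin.1 p.1.2], (p.2.1 + fin.2)%N, p.2.2).

End Semantics.

Definition stream (U : finType) (sigma : {perm U}) : seq U :=
  [seq sigma x | x <- enum U].

Section SetFunctions.
Variables (R : realType) (U : finType).

Definition monotone_fun (f : {set U} -> R) :=
  forall A B : {set U}, A \subset B -> f A <= f B.

Definition submodular (f : {set U} -> R) :=
  forall A B : {set U}, f (A :|: B) + f (A :&: B) <= f A + f B.

Definition OPT (f : {set U} -> R) (k : nat) : R :=
  \big[Num.max/f set0]_(S : {set U} | (#|S| <= k)%N) f S.

Definition expected_value (Alg : algorithm R) (f : {set U} -> R) (k : nat) : R :=
  (\sum_(sigma : {perm U}) f (outcome Alg f k (stream sigma)).1.1)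
    / (#|{perm U}|)%:R.
End SetFunctions.

(* Main.v *)
(** The stream is cut into windows of equal size and the windows into blocks.
    Inside a block the algorithm keeps, for each [l], a level [L_l] extending the
    solution committed so far by at most [l] items; at the end of a window, level
    [l + 1] may become [L_l] plus the best item among the window and the pool of
    all previous winners, and at the end of a block the top level is committed.

    Condition on the state [h] reached after [t] windows.  If an optimal item [o]
    is not in the pool, moving it from a past window to the future does not change
    [h] unless one of the few pivotal positions is touched, so up to a small error
    [o] is still to come with probability at least the fraction of the stream that
    is left.  Thinning this event, the next window brings a uniformly random optimal
    item with probability [theta = k s / n] independently of [h], and the expected
    values [F_t^l] of the levels satisfy
      [F_{t+1}^{l+1} >= (1 - theta) F_t^{l+1} + theta (F_t^l + (V - F_t^l) / k)]
    up to small errors, where [V] is nearly OPT.  A block of [q] windows, where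
    [theta q] is close to the top level [b], thus gains almost as much as [b] greedy
    steps.  Short streams are stored entirely and solved by the greedy algorithm. *)
Require Import Defs.
From HB Require Import structures.
From mathcomp Require Import all_boot all_order all_algebra.
From mathcomp Require Import all_fingroup reals sequences exp.
From mathcomp Require Import ring lra zify.
Set Implicit Arguments. Unset Strict Implicit. Unset Printing Implicit Defensive.
Import Order.TTheory GRing.Theory Num.Theory.
Local Open Scope ring_scope.

(** The obstacle is that the state of the algorithm is correlated with which items are still to
    come. Everything is therefore conditioned on the state, and the conditional probability [pi]
    that an optimal item lies in the future can miss its unconditional value [kap] on both sides. An
    excess would let level [l + 1] be charged too often for falling back to level [l], hence the
    thinning. A shortfall is harmful to the gain; the exchange bounds it, not item by item but in
    total, weighted by the marginals of the optimal items. This is what the pool is for: a past item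
    whose position influenced the state has won at some level, so it is in the pool and competes
    again in every later window, and only the other items need the exchange. Levels are needed
    because the number of optimal items hitting a block fluctuates. Its mean is about [N ^ 2] and
    its standard deviation at most [N], so that only a fraction of order [1 / N] of the gain of a
    block is lost. The gain in a block is measured against the gap to [V] left at its end, which is
    what makes one constant lower bound valid during the whole block. *)

Record params := Params {
  small : bool; wsize : nat; nwin : nat; blen : nat; nlev : nat; rounds : nat }.

(* An item is stored as a sequence of length at most one ([[::]] for no item), so
   that all fields are built by concatenation and the algorithm on buffer positions
   ([T = nat]) maps to the one on items along any monoid morphism.  [cands] holds
   the best atom seen in the current window for each of the [levels]; [pool] holds
   all past winners. *)
Record state (T : Type) := State {
  pool : seq (seq T);
  levels : seq (seq T);
  cands : seq (seq T);
  inwin : nat;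
  windone : nat }.

(** * The algorithm, over an arbitrary type of items *)

Section PureAlgorithm.
Variables (R : realType) (T : Type).
Implicit Types (v : seq T -> R) (st : state T) (p : params).

(** The comparison is strict, so ties keep the earlier candidate. This fixed rule is what lets a
    losing candidate be deleted without changing the winner. *)
Definition argbest v (L d : seq T) (Q : seq (seq T)) : seq T :=
  foldl (fun a x => if v (a ++ L) < v (x ++ L) then x else a) d Q.

Definition argbests v (D : seq (seq T * seq T * seq (seq T))) : seq (seq T) :=
  [seq argbest v t.1.1 t.1.2 t.2 | t <- D].

Definition closing p st := (inwin st).+1 == wsize p.

(** A left fold can be interrupted anywhere: the best of the window followed by the pool is found by
    storing only the current best. The pool is scanned once per window, at its last item, so other
    arrivals cost two queries per level. *)
Definition scan_queries p st (x : seq T) :=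
  if (windone st < nwin p)%N then
    [seq (Le.1, Le.2, x :: (if closing p st then pool st else [::]))
       | Le <- zip (levels st) (cands st)]
  else [::].

(** Level [l] chooses among all old levels up to [l] and all extensions of levels below [l], not
    just the two natural candidates. This makes the value nondecreasing in [l], so that committing
    the top level lowers no level. *)
Definition level_choices (ls E : seq (seq T)) :=
  [seq ([::], head [::] ls, take l.+1 ls ++ take l [seq Le.2 ++ Le.1 | Le <- zip ls E])
     | l <- iota 0 (size ls)] : seq (seq T * seq T * seq (seq T)).

Definition level_queries p st (E : seq (seq T)) :=
  if (windone st < nwin p)%N && closing p st then level_choices (levels st) E
  else [::].

Definition commit (e : bool) (ls : seq (seq T)) :=
  if e then nseq (size ls) (last [::] ls) else ls.

Definition update p st (x : seq T) (E L : seq (seq T)) : state T :=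
  if small p then
    State (rcons (pool st) x) (levels st) (cands st) (inwin st) (windone st)
  else if (windone st < nwin p)%N then
    if closing p st then
      State (pool st ++ E) (commit (blen p %| (windone st).+1)%N L)
        (nseq (size L) [::]) 0 (windone st).+1
    else State (pool st) (levels st) E (inwin st).+1 (windone st)
  else st.

Definition step v p st x :=
  let E := argbests v (scan_queries p st x) in
  update p st x E (argbests v (level_queries p st E)).

Definition greedy v (H : seq (seq T)) r S :=
  iter r (fun S => argbest v S [::] H ++ S) S.

Definition result v p st := greedy v (pool st) (rounds p) (last [::] (levels st)).

Definition items st : seq T :=
  flatten (pool st) ++ flatten (levels st) ++ flatten (cands st).

End PureAlgorithm.

Definition map_state (T1 T2 : Type) (G : seq T1 -> seq T2) (st : state T1) :=
  State (map G (pool st)) (map G (levels st)) (map G (cands st))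
    (inwin st) (windone st).

(** * The algorithm commutes with concatenation morphisms that preserve values *)

Section Naturality.
Variables (R : realType) (T1 T2 : Type) (G : seq T1 -> seq T2).
Variables (v1 : seq T1 -> R) (v2 : seq T2 -> R).
Hypothesis Gcat : forall a b, G (a ++ b) = G a ++ G b.
Hypothesis Gnil : G [::] = [::].
Hypothesis vG : forall l, v1 l = v2 (G l).

Definition map_query (t : seq T1 * seq T1 * seq (seq T1)) :=
  (G t.1.1, G t.1.2, map G t.2).

Lemma argbest_nat L d Q : G (argbest v1 L d Q) = argbest v2 (G L) (G d) (map G Q).
Proof.
elim: Q d => //= x Q IH d; rewrite -/(argbest _ _ _ _) IH !vG !Gcat.
by case: ifP.
Qed.

Lemma argbests_nat D : map G (argbests v1 D) = argbests v2 (map map_query D).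
Proof. by rewrite /argbests -!map_comp; apply: eq_map => t /=; rewrite argbest_nat. Qed.

Lemma zip_cat_nat (ls E : seq (seq T1)) :
  [seq Le.2 ++ Le.1 | Le <- zip (map G ls) (map G E)]
  = map G [seq Le.2 ++ Le.1 | Le <- zip ls E].
Proof. by elim: ls E => [|L ls IH] [|e E] //=; rewrite IH Gcat. Qed.

Lemma scan_queries_nat p st x :
  map map_query (scan_queries p st x) = scan_queries p (map_state G st) (G x).
Proof.
rewrite /scan_queries /=; case: ifP => // _; rewrite /closing /=.
elim: (levels st) (cands st) => [|L ls IH] [|e E] //=; rewrite IH /map_query /=.
by case: ifP.
Qed.

Lemma head_nat (ls : seq (seq T1)) : head [::] (map G ls) = G (head [::] ls).
Proof. by case: ls. Qed.

Lemma last_nat (ls : seq (seq T1)) : last [::] (map G ls) = G (last [::] ls).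
Proof. by rewrite -[in LHS]Gnil last_map. Qed.

Lemma level_choices_nat ls E :
  map map_query (level_choices ls E) = level_choices (map G ls) (map G E).
Proof.
rewrite /level_choices size_map -map_comp; apply: eq_map => l /=.
by rewrite /map_query /= head_nat zip_cat_nat -!map_take -map_cat Gnil.
Qed.

Lemma level_queries_nat p st E :
  map map_query (level_queries p st E) = level_queries p (map_state G st) (map G E).
Proof.
by rewrite /level_queries /closing /=; case: ifP => // _; rewrite level_choices_nat.
Qed.

Lemma commit_nat e ls : map G (commit e ls) = commit e (map G ls).
Proof. by rewrite /commit; case: e; rewrite // size_map last_nat map_nseq. Qed.

Lemma update_nat p st x E L :
  map_state G (update p st x E L)
  = update p (map_state G st) (G x) (map G E) (map G L).
Proof.
rewrite /update /closing /=; case: ifP => _; first by rewrite /map_state /= map_rcons.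
case: ifP => // _; case: ifP => // _.
by rewrite /map_state /= map_cat commit_nat map_nseq Gnil size_map.
Qed.

(** Decisions depend on [v] alone and fields arise by concatenation. The application takes for [G]
    the map from buffer positions to the items stored there. *)
Lemma step_nat p st x :
  map_state G (step v1 p st x) = step v2 p (map_state G st) (G x).
Proof.
by rewrite /step update_nat !argbests_nat scan_queries_nat level_queries_nat
  argbests_nat scan_queries_nat.
Qed.

Lemma greedy_nat H r S : G (greedy v1 H r S) = greedy v2 (map G H) r (G S).
Proof. by elim: r => //= r IH; rewrite -!/(greedy _ _ _ _) Gcat argbest_nat Gnil IH. Qed.

Lemma result_nat p st : G (result v1 p st) = result v2 p (map_state G st).
Proof. by rewrite /result greedy_nat last_nat. Qed.

End Naturality.

(** * Buffer positions, masks and renumbering *)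

Definition positions_mask (l : seq nat) : seq bool :=
  mkseq (fun j => j \in l) (foldr maxn 0 l).+1.

(** The new position of [j] after the buffer has been reduced to the positions in [l]: the number of
    kept positions before it. *)
Definition rank_in (l : seq nat) (j : nat) : nat :=
  count id (take j (positions_mask l)).

Lemma nth_positions_mask l j : nth false (positions_mask l) j = (j \in l).
Proof.
have [lt_j|le_j] := ltnP j (foldr maxn 0%N l).+1; first by rewrite nth_mkseq.
rewrite nth_default ?size_mkseq //; apply/esym/negbTE/negP => jl.
move: le_j; rewrite leqNgt ltnS => /negP[].
elim: l jl => //= x l IH; rewrite inE leq_max => /orP[/eqP->|/IH->];
  by rewrite ?leqnn ?orbT.
Qed.

Section Masks.
Variable T : eqType.
Implicit Types (m : seq bool) (s : seq T).

Lemma mem_mask_onth m s y :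
  reflect (exists2 j, nth false m j & onth s j = Some y) (y \in mask m s).
Proof.
apply: (iffP idP).
  elim: s m => [|x s IH] [|[] m] //=.
    by rewrite inE => /predU1P[->|/IH[j]]; [exists 0%N | exists j.+1].
  by move=> /IH[j]; exists j.+1.
case=> j; elim: s m j => [|x s IH] [|b m] [|j] //=.
- by move=> -> [<-]; rewrite inE eqxx.
- by move=> mj sj; case: b; rewrite ?inE (IH m j) ?orbT.
Qed.

Lemma onth_mask m s j :
  nth false m j -> onth (mask m s) (count id (take j m)) = onth s j.
Proof.
elim: s m j => [|x s IH] [|b m] [|j] //=; rewrite ?onth0n //; first by move=> ->.
by move=> mj; case: b => /=; rewrite ?add1n ?add0n /= IH.
Qed.

Lemma size_mask_take m s : size (mask m s) = count id (take (size s) m).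
Proof. by elim: s m => [|x s IH] [|b m] //=; case: b => /=; rewrite IH. Qed.

Definition at_positions s (l : seq nat) : seq T := pmap (onth s) l.

Lemma at_positions_cat s a b :
  at_positions s (a ++ b) = at_positions s a ++ at_positions s b.
Proof. exact: pmap_cat. Qed.

Lemma mem_positions_mask s l : mask (positions_mask l) s =i at_positions s l.
Proof.
move=> y; rewrite mem_pmap; apply/mem_mask_onth/mapP.
  by case=> j; rewrite nth_positions_mask => jl e; exists j.
by case=> j jl e; exists j; rewrite ?nth_positions_mask.
Qed.

Lemma at_positions_rank s u l : {subset l <= u} ->
  at_positions (mask (positions_mask u) s) (map (rank_in u) l) = at_positions s l.
Proof.
move=> lu; rewrite /at_positions.
elim: l lu => //= j l IH lu; rewrite IH => [|i il]; last by rewrite lu ?inE ?il ?orbT.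
by rewrite onth_mask // nth_positions_mask lu ?inE ?eqxx.
Qed.

Lemma size_positions_mask s l : (size (mask (positions_mask l) s) <= size l)%N.
Proof.
rewrite size_mask_take; apply: (@leq_trans (count id (positions_mask l))).
  by rewrite -[X in (_ <= count _ X)%N](cat_take_drop (size s)) count_cat leq_addr.
rewrite count_map -size_filter; apply: uniq_leq_size.
  by rewrite filter_uniq ?iota_uniq.
by move=> j; rewrite mem_filter => /andP[].
Qed.

Lemma at_positions_clip s l :
  at_positions s [seq j <- l | (j < size s)%N] = at_positions s l.
Proof.
rewrite /at_positions; elim: l => //= j l IH; case: ltnP => [_ /=|/onth_default->] //.
by rewrite IH.
Qed.

Lemma rank_in_lt u i j : i \in u -> (i < j)%N -> (rank_in u i < rank_in u j)%N.
Proof.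
rewrite /rank_in -(nth_positions_mask u).
elim: (positions_mask u) i j => [|b m IH] [|i] [|j] //=.
  by move=> ->.
by move=> mi ij; rewrite ltn_add2l IH.
Qed.

Lemma at_positions_rcons s x : at_positions (rcons s x) [:: size s] = [:: x].
Proof.
by rewrite /at_positions /= -cats1 onth_cat ltnn subnn.
Qed.

Lemma at_positions_widen s x l : all (fun j => j < size s)%N l ->
  at_positions (rcons s x) l = at_positions s l.
Proof.
rewrite /at_positions; elim: l => //= j l IH /andP[js /IH->].
by rewrite -cats1 onth_cat js.
Qed.

End Masks.

(** * Oracle programs computing the choices of the algorithm *)

Section Programs.
Variable R : realType.

Fixpoint bind (A B : Type) (p : prog R A) (k : A -> prog R B) : prog R B :=
  match p with
  | Ret a => k a
  | Ask m g => Ask m (fun r => bind (g r) k)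
  end.

Lemma run_bind (A B : Type) ans (p : prog R A) (k : A -> prog R B) :
  run ans (bind p k) = ((run ans (k (run ans p).1)).1,
                        ((run ans p).2 + (run ans (k (run ans p).1)).2)%N).
Proof.
elim: p => [a|m g IH] /=; first by case: (run _ _) => a' c; rewrite add0n.
by rewrite IH addSn.
Qed.

Fixpoint ask_best_from (L a : seq nat) (va : R) (Q : seq (seq nat))
  : prog R (seq nat) :=
  match Q with
  | [::] => Ret a
  | x :: Q' => Ask (positions_mask (x ++ L)) (fun vx =>
      if va < vx then ask_best_from L x vx Q' else ask_best_from L a va Q')
  end.

Definition ask_best L d Q : prog R (seq nat) :=
  Ask (positions_mask (d ++ L)) (fun vd => ask_best_from L d vd Q).

Fixpoint ask_bests D : prog R (seq (seq nat)) :=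
  match D with
  | [::] => Ret [::]
  | t :: D' => bind (ask_best t.1.1 t.1.2 t.2)
                 (fun a => bind (ask_bests D') (fun E => Ret (a :: E)))
  end.

Definition cost (T : Type) (D : seq (seq T * seq T * seq (seq T))) : nat :=
  sumn [seq (size t.2).+1 | t <- D].

Fixpoint ask_greedy H r S : prog R (seq nat) :=
  match r with
  | 0 => Ret S
  | r'.+1 => bind (ask_greedy H r' S)
      (fun S => bind (ask_best S [::] H) (fun a => Ret (a ++ S)))
  end.

Variable ans : seq bool -> R.
Let v l := ans (positions_mask l).

Lemma run_ask_best L d Q : run ans (ask_best L d Q) = (argbest v L d Q, (size Q).+1).
Proof.
rewrite /ask_best /=; suff -> : forall d, run ans (ask_best_from L d (v (d ++ L)) Q)
  = (argbest v L d Q, size Q) by [].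
by elim: Q => //= x Q IH {}d; rewrite -/(v (x ++ L)); case: ifP => _; rewrite IH.
Qed.

Lemma run_ask_bests D : run ans (ask_bests D) = (argbests v D, cost D).
Proof.
elim: D => // t D IH.
have -> : ask_bests (t :: D) = bind (ask_best t.1.1 t.1.2 t.2)
  (fun a => bind (ask_bests D) (fun E => Ret (a :: E))) by [].
rewrite !run_bind run_ask_best IH.
by rewrite /= addn0.
Qed.

Lemma run_ask_greedy H r S :
  run ans (ask_greedy H r S) = (greedy v H r S, (r * (size H).+1)%N).
Proof.
elim: r => // r IH.
have -> : ask_greedy H r.+1 S = bind (ask_greedy H r S)
  (fun S => bind (ask_best S [::] H) (fun a => Ret (a ++ S))) by [].
rewrite !run_bind IH run_ask_best.
by rewrite /= addn0 mulSn addnC.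
Qed.

End Programs.
Arguments ask_bests {R}.
Arguments ask_greedy {R}.

(** * Memory and query accounting *)

Section ResourceInvariant.
Variables (R : realType) (T : Type).
Implicit Types (v : seq T -> R) (st : state T) (p : params).

Definition atoms (A : seq (seq T)) := all (fun a => (size a <= 1)%N) A.

(** Each finished block has committed at most [(nlev p).-1] items. Right after a commit all levels
    coincide, so level [l] then carries no extra [l] items. *)
Definition level_bound p (w l : nat) : nat :=
  ((nlev p).-1 * (w %/ blen p) + if (blen p %| w)%N then 0 else l)%N.

Lemma level_bound_le p w l :
  (level_bound p w l <= (nlev p).-1 * (w %/ blen p) + l)%N.
Proof. by rewrite leq_add2l; case: ifP. Qed.

(** Off a block boundary the top level has used the allowance of one more block, but then
    [w %/ blen p] is still smaller than [nwin p %/ blen p], which leaves room for it. *)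
Lemma level_bound_final p w : (0 < blen p)%N -> (w <= nwin p)%N ->
  (blen p %| nwin p)%N ->
  (level_bound p w (nlev p).-1 <= (nlev p).-1 * (nwin p %/ blen p))%N.
Proof.
move=> q0 wn qn; rewrite /level_bound; case: ifP => qw.
  by rewrite addn0 leq_mul2l leq_div2r ?orbT.
rewrite addnC -mulnS leq_mul2l; apply/orP; right.
rewrite ltn_divLR // divnK // ltn_neqAle wn andbT.
by apply: contraFneq qw => ->.
Qed.

(** [c] is the number of items that have arrived. It bounds the pool in the small regime, where
    every item is stored. *)
Definition within p (c : nat) st : Prop :=
  [/\ atoms (pool st), atoms (cands st), size (cands st) = size (levels st),
      (windone st <= nwin p)%N &
  if small p then
    [/\ nwin p = 0%N, (size (pool st) <= c)%N, all (@nilp T) (levels st) & all (@nilp T) (cands st)]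
  else
    [/\ (size (pool st) <= nlev p * windone st)%N, size (levels st) = nlev p &
        forall l, (size (nth [::] (levels st) l) <= level_bound p (windone st) l)%N]].

Lemma argbest_ind (P : pred (seq T)) v L d Q :
  P d -> all P Q -> P (argbest v L d Q).
Proof. by elim: Q d => //= x Q IH d Pd /andP[Px PQ]; apply: IH => //; case: ifP. Qed.

Lemma atoms_scan v p st x : atoms (pool st) -> atoms (cands st) -> atoms [:: x] ->
  atoms (argbests v (scan_queries p st x)).
Proof.
rewrite /scan_queries; case: ifP => // _ ap ac /andP[ax _].
rewrite /argbests -map_comp /atoms all_map.
elim: (levels st) (cands st) ac => [|L ls IH] [|e E] //= /andP[ae aE].
rewrite IH // andbT; apply: (@argbest_ind (fun a => size a <= 1)%N) => //=.
  by case: ifP.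
by case: ifP.
Qed.

Lemma size_scan v p st x : size (cands st) = size (levels st) ->
  size (argbests v (scan_queries p st x)) = if (windone st < nwin p)%N then size (levels st) else 0%N.
Proof.
by rewrite /scan_queries /argbests; case: ifP => // _ e; rewrite !size_map size_zip e minnn.
Qed.

Lemma size_level_choice v (ls E : seq (seq T)) base l : atoms E ->
  (forall j, size (nth [::] ls j) <= base + j)%N ->
  (size (nth [::] (argbests v (level_choices ls E)) l) <= base + l)%N.
Proof.
move=> aE bl; have [ltl|gel] := ltnP l (size ls); last first.
  by rewrite nth_default // /argbests /level_choices !size_map size_iota.
rewrite /argbests (nth_map ([::], [::], [::])) ?size_map ?size_iota //.
rewrite /level_choices (nth_map 0%N) ?size_iota // nth_iota // add0n /=.
apply: (@argbest_ind (fun a => size a <= base + l)%N).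
  by rewrite -nth0; apply: leq_trans (bl 0%N) _; rewrite leq_add2l.
rewrite all_cat; apply/andP; split.
  apply/(all_nthP [::]) => i; rewrite size_take => ilt.
  have il : (i <= l)%N by move: ilt; case: ifP; lia.
  rewrite nth_take //; apply: leq_trans (bl i) _; lia.
apply/(all_nthP [::]) => i; rewrite size_take size_map size_zip => ilt.
have [il iE] : (i < l)%N /\ (i < size E)%N.
  by move: ilt; rewrite /minn; do 2?case: ifP; lia.
rewrite nth_take // (nth_map ([::], [::])) ?size_zip; last lia.
rewrite nth_zip_cond size_zip (_ : (i < _)%N); last lia.
rewrite /= size_cat; have := bl i; have /(all_nthP [::])/(_ i iE) := aE; lia.
Qed.

Lemma within_step v p c st x : (0 < blen p)%N -> (size x <= 1)%N ->
  within p c st -> within p c.+1 (step v p st x).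
Proof.
move=> q0 x1 [ap ac sc wn]; rewrite /step /update /within.
set E := argbests v _.
have ax : atoms [:: x] by rewrite /atoms /= x1.
have aE : atoms E by exact: atoms_scan.
case sm : (small p).
  case=> w0 pc nl nc; split => //=.
    by rewrite /atoms all_rcons x1.
  by split => //; rewrite size_rcons.
case=> pw sl bl; case: ifP => wlt; last by split.
have sE : size E = nlev p by rewrite /E size_scan // wlt.
rewrite /level_queries wlt /=; case: ifP => cl /=; last by rewrite sl; split.
rewrite cl; set L := argbests v _.
have sL : size L = nlev p by rewrite /L /argbests /level_choices !size_map size_iota.
have bL l : (size (nth [::] L l) <= (nlev p).-1 * (windone st %/ blen p) + l)%N.
  by apply: size_level_choice => // j; apply: leq_trans (bl j) (level_bound_le _ _ _).
split.
- by rewrite /atoms all_cat; apply/andP.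
- by rewrite /atoms all_nseq orbT.
- by rewrite size_nseq /commit; case: ifP; rewrite ?size_nseq.
- by [].
split => //.
- by rewrite size_cat sE mulnS addnC leq_add2l.
- by rewrite /commit; case: ifP; rewrite ?size_nseq.
- move=> l; rewrite /commit; case: ifP => dq.
    rewrite nth_nseq sL; case: ifP => // ll.
    rewrite -nth_last sL; apply: leq_trans (bL _) _; rewrite /level_bound dq.
    (* With [windone st + 1 = j * blen p], the old state counts [j - 1] committed blocks, and the
       top level adds [(nlev p).-1] items, which gives exactly the allowance of [j] blocks. *)
    case/dvdnP: dq => j ej; rewrite ej mulnK //.
    have -> : (windone st %/ blen p = j.-1)%N.
      by have := divn_eq (windone st) (blen p); have := ltn_pmod (windone st) q0; nia.
    by case: j ej => [|j] /=; nia.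
apply: leq_trans (bL l) _; rewrite /level_bound dq leq_add2r leq_mul2l.
by rewrite leq_div2r ?orbT.
Qed.

(** Extra queries at the close of a window: every level scans a pool of at most [nlev p * nwin p]
    atoms, then each of the [nlev p] levels compares at most [2 * nlev p + 2] values. *)
Definition window_cost p : nat :=
  (nlev p * (nlev p * nwin p) + nlev p * (2 * nlev p + 2))%N.

(** Amortisation: an arrival pays for its two queries per level, and a closed window pays for
    [window_cost p]. *)
Definition potential p c st : nat :=
  (2 * nlev p * c + window_cost p * windone st)%N.

Lemma cost_scan p st x : size (cands st) = size (levels st) ->
  cost (scan_queries p st x) = if (windone st < nwin p)%N then
    (size (levels st) * (if closing p st then (size (pool st)).+2 else 2))%N else 0%N.
Proof.
move=> sc; rewrite /scan_queries; case: ifP => // _; rewrite /cost -map_comp.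
rewrite (@eq_map _ _ _ (fun=> if closing p st then (size (pool st)).+2 else 2)).
  set z := (if _ then _ else _); have -> (A : Type) (s : seq A) :
    sumn [seq z | _ <- s] = (size s * z)%N by elim: s => //= a s ->; rewrite mulSn.
  by rewrite size_zip sc minnn.
by move=> Le /=; case: ifP.
Qed.

Lemma cost_levels p st E : (cost (level_queries p st E) <=
  if (windone st < nwin p)%N && closing p st then size (levels st) * (2 * size (levels st) + 2)
  else 0)%N.
Proof.
rewrite /level_queries; case: ifP => // _; rewrite /cost /level_choices -map_comp.
set z := size (levels st); rewrite -[X in (_ <= X * _)%N](size_iota 0 z).
have : all (fun l => l < z)%N (iota 0 z) by apply/allP => l; rewrite mem_iota.
elim: (iota 0 z) => //= l s IH /andP[lz /IH]; rewrite mulSn => h.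
apply: leq_add => //; rewrite size_cat !size_take -/z; do 2 case: ifP; lia.
Qed.

Lemma cost_step v p c st x : within p c st ->
  (cost (scan_queries p st x)
   + cost (level_queries p st (argbests v (scan_queries p st x)))
   + potential p c st <= potential p c.+1 (step v p st x))%N.
Proof.
case=> ap ac sc wn hs; rewrite cost_scan //.
have := cost_levels p st (argbests v (scan_queries p st x)).
set E := argbests v _ => hl.
rewrite /potential /step /update -/E.
case sm : (small p) hs.
  by case=> w0 _ _ _; move: hl; rewrite w0 ltn0 /= leqn0 => /eqP->; nia.
case=> pw sl _; move: hl; rewrite sl; case: (ltnP (windone st) (nwin p)) => _ /=; last by nia.
case: (closing p st) => /= hl; last by nia.
rewrite /window_cost; have : (nlev p * size (pool st) <= nlev p * (nlev p * nwin p))%N.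
  by rewrite leq_mul2l (leq_trans pw) ?orbT // leq_mul2l wn orbT.
nia.
Qed.

Definition memory_bound p n : nat :=
  if small p then n
  else (nlev p * nwin p + nlev p * ((nlev p).-1 * (nwin p %/ blen p) + nlev p) + nlev p)%N.

Lemma size_flatten_le (A : seq (seq T)) z : all (fun a => size a <= z)%N A ->
  (size (flatten A) <= size A * z)%N.
Proof.
by elim: A => //= a A IH /andP[az /IH]; rewrite size_cat mulSn; exact: leq_add.
Qed.

Lemma size_items p c n st : (c <= n)%N -> within p c st ->
  (size (items st) <= memory_bound p n)%N.
Proof.
move=> cn [ap ac sc wn hs]; rewrite /items !size_cat /memory_bound.
have := size_flatten_le ap; have := size_flatten_le ac; rewrite !muln1.
move=> hc hp; case: ifP hs => _.
  case=> _ pc nl nc.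
  have fn (A : seq (seq T)) : all (@nilp T) A -> size (flatten A) = 0%N.
    by elim: A => //= a A IH /andP[/nilP-> /IH].
  by rewrite (fn _ nl) (fn _ nc) !addn0 (leq_trans hp) // (leq_trans pc).
case=> pw sl bl.
have : (size (flatten (levels st)) <=
    nlev p * ((nlev p).-1 * (nwin p %/ blen p) + nlev p))%N.
  rewrite -{1}sl; apply: size_flatten_le; apply/(all_nthP [::]) => i ilt.
  apply: leq_trans (bl i) _; apply: leq_trans (level_bound_le _ _ _) _.
  rewrite leq_add ?leq_mul2l ?leq_div2r ?orbT //.
  by rewrite -sl ltnW.
have : (size (pool st) <= nlev p * nwin p)%N.
  by rewrite (leq_trans pw) // leq_mul2l wn orbT.
rewrite sc sl in hc; lia.
Qed.

Lemma within_init p : (small p -> nwin p = 0%N) ->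
  within p 0 (State [::] (nseq (nlev p) [::]) (nseq (nlev p) [::]) 0 0 : state T).
Proof.
move=> sw; split; rewrite //= /atoms ?all_nseq ?orbT //.
case: ifP => [/sw|_]; first by rewrite ?all_nseq ?orbT.
by split; rewrite ?size_nseq // => l; rewrite nth_nseq if_same.
Qed.

End ResourceInvariant.

Lemma within_map (T1 T2 : Type) (G : seq T1 -> seq T2) p c st :
  (forall l, size (G l) <= size l)%N -> G [::] = [::] ->
  within p c st -> within p c (map_state G st).
Proof.
move=> Gs G0 [ap ac sc wn hs].
have am A : atoms A -> atoms (map G A).
  rewrite /atoms all_map; apply: sub_all => a /=; exact: leq_trans.
have nm A : all (@nilp T1) A -> all (@nilp T2) (map G A).
  rewrite all_map; apply: sub_all => a /nilP -> /=; by rewrite G0.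
split; rewrite /= ?size_map //; [exact: am|exact: am|].
case: ifP hs => _ [].
  by move=> ? ? ? ?; split; rewrite ?size_map //; exact: nm.
move=> ? ? h; split; rewrite ?size_map //.
move=> l; have [ll|ll] := ltnP l (size (levels st)); last first.
  by rewrite nth_default // size_map.
by rewrite (nth_map [::]) //; apply: leq_trans (h l).
Qed.

(** * The oracle algorithm and its simulation of the pure one *)

Definition init_state (T : Type) (p : params) : state T :=
  State [::] (nseq (nlev p) [::]) (nseq (nlev p) [::]) 0 0.

(* Positions outside the buffer are dropped, so that [compress] is a monoid
   morphism whose image only contains valid positions of the new buffer. *)
Definition compress (u : seq nat) (z : nat) (l : seq nat) : seq nat :=
  [seq rank_in u j | j <- l & (j < z)%N].

(** The algorithm never sees its buffer, so the state stores positions and, as third component [z],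
    the buffer size, which is the position of the next arrival. After each update the buffer is cut
    down to the positions in use and these are renumbered. *)
Definition window_algorithm (R : realType) (par : nat -> nat -> params) : algorithm R :=
  @Algorithm R (params * state nat * nat)%type
    (fun n k => (par n k, init_state nat (par n k), 0%N))
    (fun S => let: (p, st, z) := S in
      bind (ask_bests (scan_queries p st [:: z])) (fun E =>
      bind (ask_bests (level_queries p st E)) (fun L =>
      let st' := update p st [:: z] E L in
      let u := items st' in
      Ret ((p, map_state (compress u z.+1) st', rank_in u z.+1), positions_mask u))))
    (fun S => let: (p, st, z) := S in
      bind (ask_greedy (pool st) (rounds p) (last [::] (levels st)))
        (fun l => Ret (positions_mask l))).

Lemma map_state_comp (T1 T2 T3 : Type) (G : seq T2 -> seq T3) (H : seq T1 -> seq T2) st :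
  map_state G (map_state H st) = map_state (G \o H) st.
Proof. by rewrite /map_state /= -!map_comp. Qed.

Lemma eq_map_state (T1 : eqType) (T2 : Type) (G H : seq T1 -> seq T2) st :
  (forall l, {subset l <= items st} -> G l = H l) -> map_state G st = map_state H st.
Proof.
move=> GH; rewrite /map_state.
have sub (A : seq (seq T1)) :
    {subset flatten A <= items st} -> map G A = map H A.
  move=> As; apply/eq_in_map => l lA; apply: GH => y yl; apply: As.
  by apply/flattenP; exists l.
by rewrite !sub // => y yl; rewrite /items !mem_cat yl ?orbT.
Qed.

Section Simulation.
Variables (R : realType) (U : finType) (f : {set U} -> R).
Variable par : nat -> nat -> params.
Let A := window_algorithm R par.

Definition value (l : seq U) : R := f [set y in l].

Lemma oracle_positions avail l :
  oracle f avail (positions_mask l) = value (at_positions avail l).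
Proof.
by congr f; apply/setP => y; rewrite !inE mem_positions_mask.
Qed.

Lemma at_positions_compress (avail : seq U) u l : {subset l <= u} ->
  at_positions (mask (positions_mask u) avail) (compress u (size avail) l)
  = at_positions avail l.
Proof.
move=> lu; rewrite /compress at_positions_rank ?at_positions_clip // => j.
by rewrite mem_filter => /andP[_ /lu].
Qed.

Lemma eq_argbest (T : Type) (v1 v2 : seq T -> R) L d Q :
  v1 =1 v2 -> argbest v1 L d Q = argbest v2 L d Q.
Proof. by move=> v12; elim: Q d => //= x Q IH d; rewrite !v12. Qed.

Lemma run_step avail p st z (r := run (oracle f avail) (@alg_step _ A (p, st, z)))
    (st' := step (fun l => value (at_positions avail l)) p st [:: z])
    (u := items st') :
  r = ((p, map_state (compress u z.+1) st', rank_in u z.+1), positions_mask u,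
       (cost (scan_queries p st [:: z]) + cost (level_queries p st
         (argbests (fun l => value (at_positions avail l)) (scan_queries p st [:: z]))))%N).
Proof.
have eqs D : argbests (fun l => oracle f avail (positions_mask l)) D
    = argbests (fun l => value (at_positions avail l)) D.
  by rewrite /argbests; apply: eq_map => t; apply: eq_argbest => l;
    exact: oracle_positions.
by rewrite /r /A /= !run_bind !run_ask_bests /= !eqs addn0.
Qed.

(** Reading the stored positions through the buffer yields the state of the pure algorithm on items.
    Renumbering is invisible to this reading because [compress] undoes exactly the cut made by
    [positions_mask]. The start is an arbitrary state, for the induction on the remaining stream. *)
Lemma process_simulation p s c n st buf :
  (0 < blen p)%N -> within p c st -> (c + size s <= n)%N ->
  all (fun j => j < size buf)%N (items st) -> (size buf <= memory_bound p n)%N ->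
  let r := @process R U A f (p, st, size buf) buf s in
  exists st', [/\ r.1.1 = (p, st', size r.1.2),
    map_state (at_positions r.1.2) st'
      = foldl (fun st x => step value p st [:: x]) (map_state (at_positions buf) st) s,
    within p (c + size s) st', (r.2.1 + potential p c st <= potential p (c + size s) st')%N &
    (r.2.2 <= memory_bound p n)%N].
Proof.
move=> q0; elim: s c st buf => [|x s IH] c st buf wst cn vst mbuf.
  by exists st; rewrite addn0.
rewrite [process _ _ _ _]/= run_step /=.
set v := fun l => value _.
set st1 := step v p st [:: size buf]; set u := items st1.
set buf' := mask (positions_mask u) (rcons buf x).
have w1 : within p c.+1 st1 by apply: within_step.
have cs : forall l, (size (compress u (size buf).+1 l) <= size l)%N.
  by move=> l; rewrite /compress size_map size_filter count_size.
have w2 : within p c.+1 (map_state (compress u (size buf).+1) st1) by apply: within_map.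
have szb : rank_in u (size buf).+1 = size buf'.
  by rewrite /buf' size_mask_take size_rcons.
have v2 : all (fun j => j < size buf')%N (items (map_state (compress u (size buf).+1) st1)).
  have sub A0 : {subset flatten A0 <= u} ->
      all (fun j => j < size buf')%N (flatten (map (compress u (size buf).+1) A0)).
    move=> Au; apply/allP => i /flattenP[_ /mapP[l lA ->]] /mapP[j].
    rewrite mem_filter => /andP[jz jl] ->; rewrite -szb; apply: rank_in_lt => //; apply: Au; by apply/flattenP; exists l.
  rewrite /items /= !all_cat !sub // => y yl; rewrite /u /items !mem_cat yl ?orbT //.
have m2 : (size buf' <= memory_bound p n)%N.
  apply: leq_trans (size_positions_mask _ _) _; apply: size_items w1.
  by rewrite -addn1; apply: leq_trans cn; rewrite leq_add2l.
have cn' : (c.+1 + size s <= n)%N by rewrite addSnnS.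
have [st' [e1 e2 e3 e4 e5]] := IH _ _ _ w2 cn' v2 m2.
rewrite szb; exists st'; split.
- by rewrite e1.
- rewrite e2; congr (foldl _ _ s); rewrite map_state_comp.
  rewrite (@eq_map_state _ _ _ (at_positions (rcons buf x))); last first.
    move=> l lu /=; rewrite -(size_rcons buf x); exact: at_positions_compress.
  rewrite (@step_nat _ _ _ (at_positions (rcons buf x)) v value) //; last first.
    exact: at_positions_cat.
  rewrite at_positions_rcons; congr (step _ _ _ _); apply: eq_map_state => l lu.
  by apply: at_positions_widen; apply/allP => j /lu jl; exact: (allP vst).
- by rewrite addnS -addSn.
- move: e4; rewrite addnS -addSn; set a := (process _ _ _ _).2.1.
  have := cost_step v [:: size buf] wst; rewrite -/st1 /potential /=; lia.
- by rewrite geq_max mbuf.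
Qed.

(** Separates the two halves of the proof: the resource bounds are settled here for every order of
    arrival, and the approximation ratio only concerns the pure algorithm on items. *)
Theorem outcome_simulation k s (p := par (size s) k) : (0 < blen p)%N ->
  (small p -> nwin p = 0%N) -> (blen p %| nwin p)%N ->
  let o := @outcome R U A f k s in
  [/\ o.1.1 = [set y in result value p
        (foldl (fun st x => step value p st [:: x]) (init_state U p) s)],
      (#|o.1.1| <= if small p then rounds p
         else (nlev p).-1 * (nwin p %/ blen p) + rounds p)%N,
      (o.2 <= memory_bound p (size s))%N &
      (o.1.2 <= 2 * nlev p * size s + window_cost p * nwin p
        + rounds p * (memory_bound p (size s)).+1)%N].
Proof.
move=> q0 sw qn; rewrite /outcome /=.
have w0 := within_init nat sw; rewrite -/(init_state _ _) in w0.
have vi : all (fun j => j < size ([::] : seq U))%N (items (init_state nat p)).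
  by rewrite /items /= all_cat; apply/andP; split; elim: (nlev p).
have [|st' [e1 e2 e3 e4 e5]] := @process_simulation p s 0 (size s) _ [::] q0 w0 _ vi (leq0n _).
  by rewrite add0n.
rewrite -/p e1 run_bind run_ask_greedy /=.
set g := greedy _ _ _ _.
set buf := (process _ _ _ _).1.2 in e2 *.
have eqg : g = result (fun l => value (at_positions buf l)) p st'.
  rewrite /g /result /greedy; elim: (rounds p) => //= r ->; congr (_ ++ _).
  by apply: eq_argbest => l; rewrite oracle_positions.
have eset : [set y in mask (positions_mask g) buf] = [set y in at_positions buf g].
  by apply/setP => y; rewrite !inE mem_positions_mask.
have [ap ac sc wn hs] := e3.
have sg : (size g <= rounds p + size (last [::] (levels st')))%N.
  rewrite /g /greedy; elim: (rounds p) => //= r IHr; rewrite size_cat addSn -add1n.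
  apply: leq_add => //; apply: (@argbest_ind _ _ (fun a => size a <= 1)%N) => //.
have sp : (size (pool st') <= memory_bound p (size s))%N.
  move: hs; rewrite /memory_bound; case: ifP => _ []; first by rewrite add0n.
  move=> h1 _ _; rewrite -!addnA; apply: leq_trans (leq_addr _ _); apply: leq_trans h1 _.
  by rewrite leq_mul2l wn orbT.
split.
- rewrite eset eqg (@result_nat _ _ _ (at_positions buf) _ value) //; last first.
    exact: at_positions_cat.
  by rewrite e2 /init_state /map_state /= map_nseq.
- rewrite eset cardsE; apply: leq_trans (card_size _) _.
  rewrite size_pmap; apply: leq_trans (count_size _ _) _; apply: leq_trans sg _.
  rewrite -nth_last; move: hs; case: ifP => _ [].
    move=> _ _ /(all_nthP [::]) nl _.
    have [lt|ge] := ltnP (size (levels st')).-1 (size (levels st')).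
      by rewrite (nilP (nl _ lt)) addn0.
    by rewrite nth_default // addn0.
  move=> _ sl bl; rewrite addnC leq_add2r; apply: leq_trans (bl _) _.
  by rewrite sl; apply: level_bound_final.
- by [].
- rewrite addn0; apply: leq_add; last by rewrite leq_mul2l ltnS sp orbT.
  have : (window_cost p * windone st' <= window_cost p * nwin p)%N.
    by rewrite leq_mul2l wn orbT.
  by move: e4; rewrite /potential /=; lia.
Qed.

End Simulation.

(** * Evolution of the state from window to window *)

Section BestElement.
Variables (R : realType) (T : eqType) (v : seq T -> R).

Lemma argbest_cat L d Q1 Q2 :
  argbest v L d (Q1 ++ Q2) = argbest v L (argbest v L d Q1) Q2.
Proof. exact: foldl_cat. Qed.

Lemma argbest_max L d Q a : a \in d :: Q -> v (a ++ L) <= v (argbest v L d Q ++ L).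
Proof.
suff [h1 h2] : v (d ++ L) <= v (argbest v L d Q ++ L) /\
    (forall a, a \in Q -> v (a ++ L) <= v (argbest v L d Q ++ L)).
  by rewrite inE => /predU1P[->|/h2].
elim: Q d {a} => //= x Q IH d; case: ltP => vdx.
  have [h1 h2] := IH x; split; first exact: le_trans (ltW vdx) h1.
  by move=> a; rewrite inE => /predU1P[->|/h2].
have [h1 h2] := IH d; split => // a; rewrite inE => /predU1P[->|/h2] //.
exact: le_trans vdx h1.
Qed.

(** If [a] ever takes the lead, it must lose it to a later [x]. That [x] also beats the leader of
    the run without [a], which is never better than [a] before, and from then on both runs agree. *)
Lemma argbest_remove L d Q1 Q2 a : argbest v L d (Q1 ++ a :: Q2) != a ->
  argbest v L d (Q1 ++ a :: Q2) = argbest v L d (Q1 ++ Q2).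
Proof.
rewrite !argbest_cat /=; move: (argbest v L d Q1) => c.
rewrite -/(argbest v L _ Q2); case: ltP => // /ltW.
elim: Q2 c => [c|x Q IH c vca]; first by rewrite /argbest eqxx.
rewrite /= -!/(argbest v L _ Q); case: (ltP (v (a ++ L))) => [vax|vxa].
  by rewrite (le_lt_trans vca vax).
by apply: IH; case: ifP.
Qed.

End BestElement.

Section WindowSteps.
Variables (R : realType) (T : eqType) (v : seq T -> R) (B q : nat).

Definition wstate := (seq (seq T) * seq (seq T))%type.

Definition winners (h : wstate) (W : seq T) : seq (seq T) :=
  [seq argbest v L [::] ([seq [:: x] | x <- W] ++ h.1) | L <- h.2].

Definition window_step (e : bool) (h : wstate) (W : seq T) : wstate :=
  (h.1 ++ winners h W, commit e (argbests v (level_choices h.2 (winners h W)))).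

(** The windows are a free parameter, so that the state can also be computed for a stream from which
    one position has been deleted. *)
Fixpoint window_state (W : nat -> seq T) (t : nat) : wstate :=
  if t is t'.+1 then window_step (q %| t)%N (window_state W t') (W t')
  else ([::], nseq B [::]).

Lemma eq_window_state W1 W2 t : (forall j, (j < t)%N -> W1 j = W2 j) ->
  window_state W1 t = window_state W2 t.
Proof.
elim: t => //= t IH e; rewrite IH ?e // => j jt; apply: e; exact: ltnW.
Qed.

Lemma size_level_choices_best (ls E : seq (seq T)) :
  size (argbests v (level_choices ls E)) = size ls.
Proof. by rewrite /argbests /level_choices !size_map size_iota. Qed.

Lemma size_commit e (ls : seq (seq T)) : size (commit e ls) = size ls.
Proof. by rewrite /commit; case: e; rewrite ?size_nseq. Qed.

Lemma size_window_state W t : size (window_state W t).2 = B.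
Proof.
elim: t => [|t IH] /=; first by rewrite size_nseq.
by rewrite size_commit size_level_choices_best.
Qed.

Lemma size_winners h W : size (winners h W) = size h.2.
Proof. by rewrite size_map. Qed.

Lemma pool_window_state W j t a : (j < t)%N ->
  a \in winners (window_state W j) (W j) -> a \in (window_state W t).1.
Proof.
elim: t => //= t IH; rewrite ltnS leq_eqVlt mem_cat => /predU1P[-> ->|jt].
  by rewrite orbT.
by move=> /(IH jt) ->.
Qed.

Lemma winners_remove h W1 W2 x : [:: x] \notin winners h (W1 ++ x :: W2) ->
  winners h (W1 ++ x :: W2) = winners h (W1 ++ W2).
Proof.
move=> nx; apply/eq_in_map => L hL; rewrite !map_cat /= -!catA; apply: argbest_remove.
apply: contraNneq nx => e; rewrite -e; apply/mapP; exists L => //.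
by rewrite map_cat /= -catA.
Qed.

Section StepProperties.
Variables (e : bool) (h : wstate) (W : seq T).
Let ls := argbests v (level_choices h.2 (winners h W)).
Let h' := window_step e h W.

Let nth_ls l : (l < size h.2)%N -> nth [::] ls l = argbest v [::] (head [::] h.2)
  (take l.+1 h.2 ++ take l [seq Le.2 ++ Le.1 | Le <- zip h.2 (winners h W)]).
Proof.
move=> lB; rewrite /ls /argbests (nth_map ([::], [::], [::])) ?size_map ?size_iota //.
by rewrite /level_choices (nth_map 0%N) ?size_iota // nth_iota.
Qed.

Let ls_ge l a : (l < size h.2)%N ->
  a \in take l.+1 h.2 ++ take l [seq Le.2 ++ Le.1 | Le <- zip h.2 (winners h W)] ->
  v a <= v (nth [::] ls l).
Proof.
move=> lB al; rewrite nth_ls //; rewrite -[a]cats0 -[argbest _ _ _ _]cats0.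
by apply: argbest_max; rewrite inE al orbT.
Qed.

Let ls_mono l l' : (l <= l')%N -> (l' < size h.2)%N ->
  v (nth [::] ls l) <= v (nth [::] ls l').
Proof.
move=> ll lB; have lB' := leq_ltn_trans ll lB; rewrite {1}nth_ls //.
apply: (@argbest_ind _ _ (fun a => v a <= v (nth [::] ls l'))).
  by apply: ls_ge => //; rewrite mem_cat; case: (h.2) lB => //= a s _; rewrite inE eqxx.
apply/allP => a; rewrite mem_cat => al; apply: ls_ge => //; rewrite mem_cat.
have sub (S : seq (seq T)) i j : (i <= j)%N -> {subset take i S <= take j S}.
  by move=> ij b; rewrite -[take i S](take_takel _ ij) => /mem_take.
by case/orP: al => /sub -> //; rewrite ?orbT ?ltnS.
Qed.

(** A commit replaces each level by the top one, whose value is the largest by [ls_mono]. *)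
Let commit_ge l : (l < size h.2)%N -> v (nth [::] ls l) <= v (nth [::] h'.2 l).
Proof.
move=> lB; rewrite /h' /= /commit -/ls; case: e => //.
have sls : size ls = size h.2 by exact: size_level_choices_best.
by rewrite nth_nseq sls lB -nth_last sls; apply: ls_mono; lia.
Qed.

Lemma window_step_level_le l : (l < size h.2)%N ->
  v (nth [::] h.2 l) <= v (nth [::] h'.2 l).
Proof.
move=> lB; apply: le_trans (commit_ge lB); apply: ls_ge => //.
by rewrite mem_cat (take_nth [::]) // mem_rcons inE eqxx.
Qed.

Lemma window_step_extend l a : (l.+1 < size h.2)%N ->
  a \in [:: [::] & [seq [:: x] | x <- W] ++ h.1] ->
  v (a ++ nth [::] h.2 l) <= v (nth [::] h'.2 l.+1).
Proof.
move=> lB /(argbest_max v (nth [::] h.2 l)) /le_trans; apply.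
apply: le_trans (commit_ge lB); apply: ls_ge => //; rewrite mem_cat; apply/orP; right.
have lB' := ltnW lB.
rewrite (take_nth [::]) ?size_map ?size_zip ?size_winners ?minnn //.
rewrite mem_rcons inE (nth_map ([::], [::])) ?size_zip ?size_winners ?minnn //.
by rewrite nth_zip ?size_winners //= /winners (nth_map [::]) ?eqxx.
Qed.

Lemma window_step_mono l l' : (l <= l')%N -> (l' < size h.2)%N ->
  v (nth [::] h'.2 l) <= v (nth [::] h'.2 l').
Proof.
move=> ll lB; rewrite /h' /= /commit -/ls; case: e; last exact: ls_mono.
have -> : size ls = size h.2 by exact: size_level_choices_best.
by rewrite !nth_nseq lB (leq_ltn_trans ll lB).
Qed.

End StepProperties.

Lemma window_state_mono W t l l' : (l <= l')%N -> (l' < B)%N ->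
  v (nth [::] (window_state W t).2 l) <= v (nth [::] (window_state W t).2 l').
Proof.
case: t => [|t] ll lB; first by rewrite !nth_nseq lB (leq_ltn_trans ll lB).
by apply: window_step_mono; rewrite ?size_window_state.
Qed.

Lemma window_state_block W t l : (q %| t)%N -> (l < B)%N ->
  nth [::] (window_state W t).2 l = nth [::] (window_state W t).2 B.-1.
Proof.
move=> qt lB; have B0 : (B.-1 < B)%N by lia.
case: t qt => [|t] /= qt; first by rewrite !nth_nseq lB B0.
by rewrite qt /= size_level_choices_best size_window_state !nth_nseq lB B0.
Qed.

End WindowSteps.

Section OnlineWindows.
Variables (R : realType) (T : eqType) (v : seq T -> R) (p : params).
Hypothesis nsmall : small p = false.
Hypothesis wsize_gt0 : (0 < wsize p)%N.
Let steps st s := foldl (fun st x => step v p st [:: x]) st s.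
Let boundary (h : wstate T) w := State h.1 h.2 (nseq (size h.2) [::]) 0 w.

Let zip_graph (A B : Type) (F : A -> B) s : zip s (map F s) = [seq (x, F x) | x <- s].
Proof. by elim: s => //= x s ->. Qed.

Let scan_graph (h : wstate T) (Q1 Q2 : seq (seq T)) :
  argbests v [seq (Le.1, Le.2, Q2) | Le <- zip h.2 [seq argbest v L [::] Q1 | L <- h.2]]
  = [seq argbest v L [::] (Q1 ++ Q2) | L <- h.2].
Proof.
rewrite /argbests zip_graph -!map_comp; apply: eq_map => L /=.
by rewrite argbest_cat.
Qed.

Lemma steps_partial_window h w W : (w < nwin p)%N -> (size W < wsize p)%N ->
  steps (boundary h w) W = State h.1 h.2
    [seq argbest v L [::] [seq [:: x] | x <- W] | L <- h.2] (size W) w.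
Proof.
move=> wn; elim/last_ind: W => [_|W x IH].
  by rewrite /steps /boundary /=; congr State; elim: (h.2) => //= a s ->.
rewrite size_rcons => sW; rewrite /steps -cats1 foldl_cat -/(steps (boundary h w) W) IH; last exact: ltnW.
rewrite /= /step /update nsmall /scan_queries /closing /= wn (ltn_eqF sW).
by rewrite scan_graph map_cat.
Qed.

Lemma steps_window h w W : (w < nwin p)%N -> size W = wsize p ->
  steps (boundary h w) W = boundary (window_step v (blen p %| w.+1)%N h W) w.+1.
Proof.
move=> wn; case/lastP: W => [e|W x]; first by move: wsize_gt0; rewrite -e.
rewrite size_rcons => sW; rewrite /steps -cats1 foldl_cat -/(steps (boundary h w) W).
rewrite steps_partial_window ?sW // /= /step /update nsmall.
rewrite /scan_queries /level_queries /closing /= wn sW eqxx /= scan_graph.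
rewrite /boundary /window_step /= size_commit.
have -> : [seq argbest v L [::] ([seq [:: x0] | x0 <- W] ++ [:: x] :: h.1) | L <- h.2]
   = winners v h (W ++ [:: x]) by apply: eq_map => L; rewrite map_cat /= -catA.
by rewrite size_level_choices_best.
Qed.

Lemma steps_windows s t : (t <= nwin p)%N -> (t * wsize p <= size s)%N ->
  steps (init_state T p) (take (t * wsize p) s)
  = boundary (window_state v (nlev p) (blen p)
      (fun j => take (wsize p) (drop (j * wsize p) s)) t) t.
Proof.
elim: t => [|t IH] tn ts; first by rewrite take0 /boundary /= size_nseq.
have ts' : (t * wsize p <= size s)%N by apply: leq_trans ts; rewrite leq_mul2r leqnSn orbT.
rewrite mulSn addnC takeD /steps foldl_cat -/(steps (init_state T p) _) IH //; last exact: ltnW.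
rewrite -/(steps (boundary _ _) _) steps_window // size_takel // size_drop; lia.
Qed.

Lemma result_windows s : (nwin p * wsize p <= size s)%N -> rounds p = 0%N ->
  result v p (steps (init_state T p) s)
  = last [::] (window_state v (nlev p) (blen p)
      (fun j => take (wsize p) (drop (j * wsize p) s)) (nwin p)).2.
Proof.
move=> ns r0; rewrite -{1}(cat_take_drop (nwin p * wsize p) s) /steps foldl_cat.
rewrite -/(steps (init_state T p) _) steps_windows //.
set st := boundary _ _.
(* Items after the last window are ignored. *)
have -> s' : foldl (fun st x => step v p st [:: x]) st s' = st.
  elim: s' => //= x s' IH; rewrite (_ : step v p st [:: x] = st) //.
  by rewrite /step /update nsmall ltnn.
by rewrite /result r0.
Qed.

End OnlineWindows.

Section OnlineGreedy.
Variables (R : realType) (T : eqType) (v : seq T -> R) (p : params).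
Hypothesis is_small : small p.

Lemma result_small s :
  result v p (foldl (fun st x => step v p st [:: x]) (init_state T p) s)
  = greedy v [seq [:: x] | x <- s] (rounds p) [::].
Proof.
have -> : foldl (fun st x => step v p st [:: x]) (init_state T p) s
  = State [seq [:: x] | x <- s] (nseq (nlev p) [::]) (nseq (nlev p) [::]) 0 0.
  elim/last_ind: s => // s x IH; rewrite -cats1 foldl_cat IH /= /step /update is_small /=.
  by rewrite map_cat cats1.
by rewrite /result /=; congr greedy; elim: (nlev p) => //= -[].
Qed.

End OnlineGreedy.

(** * Submodularity and the greedy algorithm for short streams *)

Section Submodular.
Variables (R : realType) (U : finType) (f : {set U} -> R).
Hypotheses (f_mono : monotone_fun f) (f_sub : submodular f) (f0 : 0 <= f set0).

Lemma f_ge0 S : 0 <= f S.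
Proof. by apply: le_trans f0 _; apply: f_mono; rewrite sub0set. Qed.

Lemma OPT_attained k : exists O : {set U}, (#|O| <= k)%N /\ f O = OPT f k.
Proof.
rewrite /OPT; apply: (big_ind (fun x => exists O : {set U}, (#|O| <= k)%N /\ f O = x)).
- by exists set0; rewrite cards0.
- move=> x y [O1 [c1 e1]] [O2 [c2 e2]]; rewrite /Num.max.
  by case: ifP => _; [exists O2|exists O1].
- by move=> S Sk; exists S.
Qed.

(* Marginals of the elements of [s] added one by one on top of [L]: unlike the
   marginals over [L] alone, their sum is bounded by the value of [s]. *)
Definition marginal (s : seq U) (L : {set U}) (o : U) : R :=
  f (L :|: [set y in take (index o s).+1 s]) - f (L :|: [set y in take (index o s) s]).

Lemma marginal_ge0 s L o : 0 <= marginal s L o.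
Proof.
rewrite subr_ge0; apply: f_mono; apply: setUS; apply/subsetP => y; rewrite !inE.
by rewrite -[take (index o s) s](@take_takel _ _ (index o s).+1) // => /mem_take.
Qed.

(** Submodularity for [L :|: P] and [o |: L], where [P] is the part of [s] before [o]: the
    intersection contains [L], so its value is at least [f L]. *)
Lemma marginal_le s L o : o \in s -> marginal s L o <= f (o |: L) - f L.
Proof.
move=> os; rewrite /marginal (take_nth o) ?index_mem // nth_index //.
set P := [set y in take _ _].
have := f_sub (L :|: P) (o |: L).
have -> : (L :|: P) :|: (o |: L) = L :|: [set y in rcons (take (index o s) s) o].
  apply/setP => y; rewrite !inE mem_rcons inE.
  by case: (y \in L); case: (y == o); rewrite ?orbT ?orbF.
have : f L <= f ((L :|: P) :&: (o |: L)).
  by apply: f_mono; rewrite subsetI subsetUl subsetUr.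
lra.
Qed.

Lemma sum_marginal s L : uniq s ->
  \sum_(o <- s) marginal s L o = f (L :|: [set y in s]) - f L.
Proof.
move=> us; case: s us => [|x0 s0] us.
  rewrite big_nil; have -> : L :|: [set y in [::]] = L; last by rewrite subrr.
  by apply/setP => y; rewrite !inE orbF.
set s := x0 :: s0 in us *.
rewrite (big_nth x0) big_mkord.
rewrite (eq_bigr (fun i : 'I_(size s) => f (L :|: [set y in take i.+1 s])
   - f (L :|: [set y in take i s]))) => [|i _]; last by rewrite /marginal index_uniq.
rewrite -(big_mkord xpredT (fun i => f (L :|: [set y in take i.+1 s])
   - f (L :|: [set y in take i s]))) telescope_sumr // take_size take0.
by congr (_ - f _); apply/setP => y; rewrite !inE orbF.
Qed.

(** After telescoping, submodularity and nonnegativity suffice. With [s] enumerating an optimal set,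
    this is the bound [M] of the exchange argument. *)
Lemma sum_marginal_le s L : uniq s ->
  \sum_(o <- s) marginal s L o <= f [set y in s].
Proof.
move=> us; rewrite sum_marginal //.
have := f_sub L [set y in s]; have := f_ge0 (L :&: [set y in s]); lra.
Qed.

Lemma sum_marginal_ge s L : uniq s ->
  f [set y in s] - f L <= \sum_(o <- s) marginal s L o.
Proof.
by move=> us; rewrite sum_marginal // lerD2r; apply: f_mono; rewrite subsetUr.
Qed.

Lemma value_cons o L : value f (o :: L) = f (o |: [set y in L]).
Proof. by rewrite /value; congr f; apply/setP => y; rewrite !inE. Qed.

Lemma greedy_value (s : seq U) k r : (0 < k)%N -> (forall x, x \in s) ->
  OPT f k - value f (greedy (value f) [seq [:: x] | x <- s] r [::])
    <= (1 - k%:R^-1) ^+ r * OPT f k.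
Proof.
move=> k0 sall; have [O [Ok eO]] := OPT_attained k.
have kR : 0 < k%:R :> R by rewrite ltr0n.
have k1 : 0 <= 1 - k%:R^-1 :> R by rewrite subr_ge0 invf_le1 // ler1n.
elim: r => [|r IH].
  by rewrite /greedy /= expr0 mul1r lerBlDr lerDl /value f_ge0.
rewrite /greedy /= -/(greedy _ _ _ _); set S := greedy _ _ _ _ in IH *.
set S' := _ ++ S.
have hS' a : a \in [::] :: [seq [:: x] | x <- s] -> value f (a ++ S) <= value f S'.
  exact: argbest_max.
have h0 : value f S <= value f S' by apply: (hS' [::]); rewrite inE eqxx.
have hm : \sum_(o <- enum O) marginal (enum O) [set y in S] o
    <= \sum_(o <- enum O) (value f S' - value f S).
  rewrite big_seq [leRHS]big_seq; apply: ler_sum => o oO.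
  apply: le_trans (marginal_le _ oO) _; rewrite lerD2r -value_cons.
  by apply: (hS' [:: o]); rewrite inE map_f ?orbT.
have := le_trans (sum_marginal_ge [set y in S] (enum_uniq O)) hm.
rewrite big_const_seq count_predT iter_addr_0 -cardE.
have -> : [set y in enum O] = O by apply/setP => y; rewrite inE mem_enum.
rewrite eO -/(value f S) => h.
have h2 : (value f S' - value f S) *+ #|O| <= k%:R * (value f S' - value f S).
  by rewrite -[leLHS]mulr_natl ler_wpM2r ?subr_ge0 // ler_nat.
have h3 : OPT f k - value f S' <= (1 - k%:R^-1) * (OPT f k - value f S).
  have : k%:R^-1 * (OPT f k - value f S) <= value f S' - value f S.
    by rewrite ler_pdivrMl // (le_trans h).
  lra.
by rewrite exprS -mulrA; apply: le_trans h3 _; apply: ler_wpM2l.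
Qed.

Lemma greedy_ratio (s : seq U) k : (0 < k)%N -> (forall x, x \in s) ->
  (1 - expR (-1)) * OPT f k
    <= value f (greedy (value f) [seq [:: x] | x <- s] k [::]).
Proof.
move=> k0 sall; have := greedy_value k k0 sall.
have kR : 0 < k%:R :> R by rewrite ltr0n.
have [O [_ eO]] := OPT_attained k; have : 0 <= OPT f k by rewrite -eO f_ge0.
have : (1 - k%:R^-1) ^+ k <= expR (-1) :> R.
  have -> : expR (-1) = expR (- k%:R^-1) ^+ k :> R.
    by rewrite -expRM_natl mulrN divff ?gt_eqF.
  apply: lerXn2r; rewrite ?nnegrE ?expR_ge0 ?subr_ge0 ?invf_le1 ?ler1n //.
  exact: expR_ge1Dx.
nra.
Qed.

End Submodular.

(** * Symmetry of the random order and the exchange of past and future *)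

Lemma sum_const_subset (R : realType) (U : finType) (c : U -> R) (A W : {set U}) :
  {in A &, forall x y, c x = c y} -> W \subset A ->
  #|A|%:R * \sum_(p in W) c p = #|W|%:R * \sum_(p in A) c p.
Proof.
move=> cA WA; have [->|[w wW]] := set_0Vmem W; first by rewrite big_set0 cards0 mulr0 mul0r.
have wA := subsetP WA _ wW.
have cst (S : {set U}) : S \subset A -> \sum_(p in S) c p = #|S|%:R * c w.
  move=> SA; rewrite (eq_bigr (fun=> c w)) ?sumr_const ?mulr_natl // => p pS.
  by apply: cA => //; apply: (subsetP SA).
by rewrite !cst // mulrCA.
Qed.

Section RandomOrder.
Variables (R : realType) (U : finType) (v : seq U -> R) (B q s m : nat).
Variable pos : nat -> seq U.
Hypothesis pos_uniq : forall j, (j < m)%N -> uniq (pos j).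
Hypothesis pos_size : forall j, (j < m)%N -> size (pos j) = s.
Hypothesis pos_disj : forall i j p, (i < m)%N -> (j < m)%N ->
  p \in pos i -> p \in pos j -> i = j.

Definition stream_state (sigma : {perm U}) (t : nat) : wstate U :=
  window_state v B q (fun j => map sigma (pos j)) t.

Variable t : nat.
Hypothesis tm : (t < m)%N.
Let st sigma := stream_state sigma t.

(** The future starts with the current window [t] and includes the positions that belong to no
    window. *)
Definition future : {set U} := [set p | all (fun j => p \notin pos j) (iota 0 t)].
Definition window : {set U} := [set p in pos t].

Lemma futureP p : reflect (forall j, (j < t)%N -> p \notin pos j) (p \in future).
Proof.
rewrite inE; apply: (iffP allP) => h j; first by move=> jt; apply: h; rewrite mem_iota.
by rewrite mem_iota add0n => /h.
Qed.

Lemma pastP p : p \notin future -> exists2 j, (j < t)%N & p \in pos j.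
Proof.
rewrite inE => /allPn[j]; rewrite mem_iota add0n => /= jt; rewrite negbK => h.
by exists j.
Qed.

Lemma window_future : window \subset future.
Proof.
apply/subsetP => p; rewrite inE => pt; apply/futureP => j jt; apply/negP => pj.
by have := pos_disj (ltn_trans jt tm) tm pj pt; lia.
Qed.

Lemma card_window : #|window| = s.
Proof. by rewrite cardsE (card_uniqP (pos_uniq tm)) pos_size. Qed.

Lemma card_future : (#|future| + t * s = #|U|)%N.
Proof.
have -> : (t * s)%N = #|~: future|.
  have -> : ~: future = \bigcup_(j < t) [set p in pos j].
    apply/setP => p; rewrite inE; apply/idP/bigcupP.
      by move/pastP=> [j jt pj]; exists (Ordinal jt); rewrite ?inE.
    by case=> j _; rewrite inE => pj; apply/negP => /futureP/(_ j (ltn_ord j)); rewrite pj.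
  rewrite -sum1_card partition_disjoint_bigcup => [|i j ij].
    rewrite (eq_bigr (fun=> s)) ?sum_nat_const ?card_ord // => j _.
    have jm := ltn_trans (ltn_ord j) tm.
    by rewrite sum1_card cardsE (card_uniqP (pos_uniq jm)) pos_size.
  apply/pred0P => p /=; rewrite !inE; apply/negP => /andP[pi pj].
  move/eqP: ij; apply; apply/val_inj/(pos_disj _ _ pi pj); exact: ltn_trans tm.
exact: cardsC.
Qed.

Let swap_perm (p p' : U) (g : {perm U} -> R) :
  \sum_sigma g sigma = \sum_sigma g (tperm p p' * sigma)%g.
Proof. by rewrite (reindex_inj (mulgI (tperm p p'))). Qed.

Let swap_inv (p p' o : U) (sigma : {perm U}) :
  (tperm p p' * sigma)^-1%g o = tperm p p' (sigma^-1 o)%g.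
Proof. by rewrite invMg permM tpermV. Qed.

Let swap_map (p p' : U) (sigma : {perm U}) (l : seq U) : p \notin l -> p' \notin l ->
  map (tperm p p' * sigma)%g l = map sigma l.
Proof.
move=> pl pl'; apply/eq_in_map => y yl; rewrite permM tpermD //;
  by [apply: contraNneq pl => -> | apply: contraNneq pl' => ->].
Qed.

Lemma stream_state_swap p p' sigma : p \in future -> p' \in future ->
  st (tperm p p' * sigma)%g = st sigma.
Proof.
move=> /futureP pF /futureP pF'; apply: eq_window_state => j jt.
by rewrite swap_map ?pF ?pF'.
Qed.

(** Elements of [U] also serve as names of positions: the stream of [sigma] shows the item [sigma p]
    at position [p]. *)
Definition at_pos (sigma : {perm U}) (o : U) : U := (sigma^-1 o)%g.

Lemma sum_at_pos (A : {set U}) sigma o :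
  \sum_(p in A) (at_pos sigma o == p)%:R = (at_pos sigma o \in A)%:R :> R.
Proof.
have [oA|oA] := boolP (_ \in A).
  rewrite (bigD1 (at_pos sigma o)) //= eqxx big1 ?addr0 // => p /andP[_ /negbTE h].
  by rewrite eq_sym h.
by rewrite big1 // => p pA; case: eqP => // e; rewrite e pA in oA.
Qed.

(** The state ignores a swap of two future positions, so an item in the future is equally likely to
    be at any of them, even given the state. *)
Lemma hit_window (g : wstate U -> R) o :
  #|future|%:R * \sum_sigma (at_pos sigma o \in window)%:R * g (st sigma)
  = s%:R * \sum_sigma (at_pos sigma o \in future)%:R * g (st sigma).
Proof.
pose c p := \sum_sigma (at_pos sigma o == p)%:R * g (st sigma).
have sumc (A : {set U}) : \sum_sigma (at_pos sigma o \in A)%:R * g (st sigma)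
    = \sum_(p in A) c p.
  rewrite exchange_big /=; apply: eq_bigr => sigma _.
  by rewrite -mulr_suml sum_at_pos.
rewrite !sumc -card_window; apply: sum_const_subset; last exact: window_future.
move=> p p' pF pF'; rewrite /c (swap_perm p p'); apply: eq_bigr => sigma _.
rewrite stream_state_swap // /at_pos swap_inv; congr (_%:R * _).
by rewrite -(inj_eq (@perm_inj _ (tperm p p'))) tpermK tpermL.
Qed.

(** Negative correlation: once [o] occupies a position of the window, [o'] competes for the [s - 1]
    others among [#|future| - 1]. *)
Lemma hit_window_pair (g : wstate U -> R) o o' : (forall h, 0 <= g h) -> o != o' ->
  #|future|%:R * \sum_sigma (at_pos sigma o \in window)%:R
     * (at_pos sigma o' \in window)%:R * g (st sigma)
  <= s%:R * \sum_sigma (at_pos sigma o \in window)%:R * g (st sigma).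
Proof.
move=> g0 oo'; set X := \sum_sigma _; set Y := \sum_sigma _.
have XY : X <= Y.
  apply: ler_sum => sigma _; rewrite -mulrA ler_wpM2l ?ler0n //.
  by rewrite ler_piMl // lern1 leq_b1.
(* Adding [X <= Y] turns this sharper inequality into the stated one. *)
suff h : (#|future|%:R - 1) * X <= (s%:R - 1) * Y by lra.
pose d p p' := \sum_sigma (at_pos sigma o == p)%:R
   * (at_pos sigma o' == p')%:R * g (st sigma).
have -> : X = \sum_(p in window) \sum_(p' in window :\ p) d p p'.
  rewrite /X (eq_bigr (fun sigma => \sum_(p in window) \sum_(p' in window :\ p)
     (at_pos sigma o == p)%:R * (at_pos sigma o' == p')%:R * g (st sigma))).
    rewrite exchange_big; apply: eq_bigr => p _; exact: exchange_big.
  move=> sigma _; rewrite -sum_at_pos !mulr_suml; apply: eq_bigr => p _.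
  rewrite -mulr_suml -mulr_sumr sum_at_pos in_setD1.
  case: eqP => [<-|]; last by rewrite !mul0r.
  by rewrite /at_pos (inj_eq (@perm_inj _ _)) eq_sym oo'.
have -> : Y = \sum_(p in window) \sum_sigma (at_pos sigma o == p)%:R * g (st sigma).
  rewrite exchange_big; apply: eq_bigr => sigma _.
  by rewrite -mulr_suml sum_at_pos.
rewrite !mulr_sumr; apply: ler_sum => p pW.
have pF := subsetP window_future _ pW.
have cF : #|future|%:R - 1 = #|future :\ p|%:R :> R.
  by rewrite (cardsD1 p future) pF natrD addrC addKr.
have cW : s%:R - 1 = #|window :\ p|%:R :> R.
  by rewrite -card_window (cardsD1 p window) pW natrD addrC addKr.
rewrite cF cW sum_const_subset; last by rewrite setSD ?window_future.
  rewrite ler_wpM2l ?ler0n // /d exchange_big; apply: ler_sum => sigma _.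
  rewrite -mulr_suml -mulr_sumr sum_at_pos -mulrA ler_wpM2l ?ler0n //.
  by rewrite ler_piMl // lern1 leq_b1.
move=> x y; rewrite !in_setD1 => /andP[xp xF] /andP[yp yF].
rewrite /d (swap_perm x y); apply: eq_bigr => sigma _.
rewrite stream_state_swap // /at_pos !swap_inv; congr (_%:R * _%:R * _).
  by rewrite -(inj_eq (@perm_inj _ (tperm x y))) tpermK tpermD.
by rewrite -(inj_eq (@perm_inj _ (tperm x y))) tpermK tpermL.
Qed.

(** The state had position [p] been skipped. It does not depend on the item at [p], so it survives a
    swap of [p] with any future position. *)
Definition punctured (p : U) (sigma : {perm U}) : wstate U :=
  window_state v B q (fun j => map sigma [seq y <- pos j | y != p]) t.

Definition pivotal (j : nat) (p : U) (sigma : {perm U}) : bool :=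
  [:: sigma p] \in winners v (stream_state sigma j) (map sigma (pos j)).

(** An item that wins at no level can be deleted from its window without changing the winners
    ([winners_remove]), and later windows depend on it only through the state. *)
Lemma state_punctured p j sigma : (j < t)%N -> p \in pos j -> ~~ pivotal j p sigma ->
  st sigma = punctured p sigma.
Proof.
move=> jt pj np; rewrite /st /stream_state /punctured.
pose W' j := map sigma [seq y <- pos j | y != p].
suff : forall i, (i <= t)%N -> window_state v B q (fun j => map sigma (pos j)) i
   = window_state v B q W' i by move/(_ t (leqnn t)).
elim=> // i IH it; rewrite /= -IH; last exact: ltnW.
rewrite /window_step.
suff -> : winners v (window_state v B q (fun j => map sigma (pos j)) i) (map sigma (pos i))
  = winners v (window_state v B q (fun j => map sigma (pos j)) i) (W' i) by [].
have im := ltn_trans it tm; have jm := ltn_trans jt tm; rewrite /W'.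
have [pi|pi] := boolP (p \in pos i); last first.
  congr (winners _ _ (map _ _)); apply/esym/all_filterP/allP => y yi.
  by apply: contraNneq pi => <-.
have ij := pos_disj im jm pi pj; subst i.
have := pos_uniq jm; move: np; rewrite /pivotal /stream_state.
case/splitPr: pi => p1 p2; rewrite !map_cat /= => np.
rewrite cat_uniq /= negb_or => /and3P[_ /andP[pp1 _] /andP[pp2 _]].
rewrite winners_remove // -map_cat filter_cat /= eqxx.
have flt (l : seq U) : p \notin l -> [seq y <- l | y != p] = l.
  by move=> pl; apply/all_filterP/allP => y yl; apply: contraNneq pl => <-.
by rewrite !flt.
Qed.

Lemma punctured_swap p p' sigma : p' \in future ->
  punctured p (tperm p p' * sigma)%g = punctured p sigma.
Proof.
move=> /futureP pF'; apply: eq_window_state => j jt; rewrite swap_map //.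
  by rewrite mem_filter eqxx.
by rewrite mem_filter negb_and pF' ?orbT.
Qed.

(** A window has one winner per level, and distinct positions hold distinct items. *)
Lemma card_pivotal j sigma : (j < m)%N ->
  (\sum_(p in [set p in pos j]) pivotal j p sigma <= B)%N.
Proof.
move=> jm; rewrite -big_mkcondr sum1_card.
rewrite -(size_window_state v B q (fun j => map sigma (pos j)) j).
rewrite -(size_winners v _ (map sigma (pos j))) cardE -(size_map (fun p => [:: sigma p])).
apply: uniq_leq_size.
  rewrite map_inj_uniq ?enum_uniq // => x y [] /perm_inj //.
by move=> x /mapP[p]; rewrite mem_enum unfold_in => /andP[_ h] ->.
Qed.

Section Exchange.
Variables (psi : wstate U -> U -> R) (O : {set U}) (M : R).
Hypothesis psi_ge0 : forall h o, 0 <= psi h o.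
Hypothesis psi_pool : forall (h : wstate U) o, [:: o] \in h.1 -> psi h o = 0.
Hypothesis psi_sum : forall h, \sum_(o in O) psi h o <= M.

(** If [o] sits at the past position [p] and is not in the pool, then [p] was not pivotal and the
    state equals the punctured one. The latter is unchanged when [o] is moved to [p'] by a swap. If
    [o] is in the pool, [psi] vanishes. *)
Let exchange_one p p' o : p \notin future -> p' \in future ->
  \sum_sigma (at_pos sigma o == p)%:R * psi (st sigma) o
  <= \sum_sigma (at_pos sigma o == p')%:R * psi (punctured p sigma) o.
Proof.
move=> pF pF'; rewrite [leRHS](swap_perm p p'); apply: ler_sum => sigma _.
have -> : (at_pos (tperm p p' * sigma) o == p') = (at_pos sigma o == p).
  rewrite /at_pos swap_inv -[RHS](inj_eq (@perm_inj _ (tperm p p'))).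
  by rewrite tpermL.
rewrite punctured_swap //; case: eqP => [e|_]; last by rewrite !mul0r.
rewrite !mul1r; have [op|op] := boolP ([:: o] \in (st sigma).1).
  by rewrite psi_pool.
have [j jt pj] := pastP pF; rewrite (state_punctured jt pj) //.
apply: contra op; rewrite /pivotal -e /at_pos permKV.
exact: (pool_window_state jt).
Qed.

(** After the swap the punctured state has to be turned back into the true one. They differ only if
    the new item at [p] is pivotal, and then the error is at most the total mass [M]. *)
Let exchange_position p : p \notin future ->
  #|future|%:R * \sum_(o in O) \sum_sigma (at_pos sigma o == p)%:R * psi (st sigma) o
  <= \sum_(o in O) \sum_sigma (at_pos sigma o \in future)%:R * psi (st sigma) o
     + M * \sum_sigma (\sum_(j < t) ((p \in pos j) && pivotal j p sigma))%:R.
Proof.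
move=> pF.
apply: (@le_trans _ _ (\sum_(o in O) \sum_sigma
    (at_pos sigma o \in future)%:R * psi (punctured p sigma) o)).
  rewrite mulr_sumr; apply: ler_sum => o _.
  apply: (@le_trans _ _ (\sum_(p' in future) \sum_sigma
    (at_pos sigma o == p')%:R * psi (punctured p sigma) o)).
    rewrite mulr_natl -sumr_const; apply: ler_sum => p' pF'.
    exact: exchange_one.
  rewrite exchange_big; apply: ler_sum => sigma _.
  by rewrite -mulr_suml sum_at_pos.
rewrite exchange_big [X in _ <= X + _]exchange_big mulr_sumr -big_split.
apply: ler_sum => sigma _ /=.
have [j jt pj] := pastP pF.
have [pv|npv] := boolP (pivotal j p sigma); last first.
  rewrite (state_punctured jt pj npv) lerDl mulr_ge0 ?ler0n //.
  by apply: le_trans (psi_sum (st sigma)); apply: sumr_ge0.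
apply: (@le_trans _ _ M).
  apply: le_trans (psi_sum (punctured p sigma)); apply: ler_sum => o _.
  by rewrite ler_piMl // lern1 leq_b1.
apply: (@le_trans _ _ (M * (\sum_(j < t) ((p \in pos j) && pivotal j p sigma))%:R)).
  rewrite ler_peMr ?ler1n //; first by apply: le_trans (psi_sum (st sigma)); apply: sumr_ge0.
  by rewrite (bigD1 (Ordinal jt)) //= pj pv.
by rewrite lerDr; apply: sumr_ge0 => o _; rewrite mulr_ge0 ?ler0n.
Qed.

(* The element [o] of a past window and a future element trade places; the state
   does not notice unless one of them is pivotal, and few positions are. *)
Lemma exchange_past_future :
  #|future|%:R * \sum_(o in O) \sum_sigma (at_pos sigma o \notin future)%:R * psi (st sigma) o
  <= (t * s)%:R * \sum_(o in O) \sum_sigma (at_pos sigma o \in future)%:R * psi (st sigma) o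
     + M * (t * B)%:R * #|{perm U}|%:R.
Proof.
have M0 : 0 <= M.
  by apply: le_trans (psi_sum ([::], [::])); apply: sumr_ge0.
rewrite (eq_bigr (fun o => \sum_(p in ~: future) \sum_sigma
    (at_pos sigma o == p)%:R * psi (st sigma) o)); last first.
  move=> o _; rewrite [RHS]exchange_big; apply: eq_bigr => sigma _.
  by rewrite -mulr_suml sum_at_pos in_setC.
rewrite exchange_big mulr_sumr.
apply: le_trans (ler_sum _ _) _.
  by move=> p; rewrite inE => pF; apply: exchange_position pF.
rewrite big_split /= sumr_const; apply: lerD.
  rewrite -[leLHS]mulr_natl; have -> // : #|~: future| = (t * s)%N.
  by have := card_future; have := cardsC future; lia.
rewrite -mulr_sumr -mulrA ler_wpM2l // exchange_big /=.
rewrite mulrC mulr_natl -sumr_const; apply: ler_sum => sigma _.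
rewrite -natr_sum ler_nat exchange_big /=.
apply: (@leq_trans (\sum_(j < t) B)); last by rewrite sum_nat_const card_ord.
apply: leq_sum => j _; apply: leq_trans (card_pivotal sigma (ltn_trans (ltn_ord j) tm)).
rewrite [leqRHS]big_mkcond [leqLHS]big_mkcond /=; apply: leq_sum => p _; rewrite !inE.
by case: ifP => _; case: (p \in pos j).
Qed.

End Exchange.

(** The conditional probability, given state [h], that [o] is still to come; for an unreachable [h]
    the quotient is 0. *)
Definition cond_future (h : wstate U) (o : U) : R :=
  (\sum_sigma (st sigma == h)%:R * (at_pos sigma o \in future)%:R)
  / \sum_sigma (st sigma == h)%:R.

Lemma cond_future_ge0 h o : 0 <= cond_future h o.
Proof.
by rewrite divr_ge0 //; apply: sumr_ge0 => sigma _; rewrite ?mulr_ge0 ?ler0n.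
Qed.

(** The tower property: [g] depends on the state alone, so the indicator may be averaged over all
    orders leading to the same state. *)
Lemma sum_cond_future (g : wstate U -> R) o :
  \sum_sigma (at_pos sigma o \in future)%:R * g (st sigma)
  = \sum_sigma cond_future (st sigma) o * g (st sigma).
Proof.
pose C h : R := \sum_sigma (st sigma == h)%:R.
have C0 sigma : C (st sigma) != 0.
  rewrite gt_eqF // /C (bigD1 sigma) //= eqxx; apply: ltr_pwDl; first by [].
  by apply: sumr_ge0 => tau _; rewrite ler0n.
transitivity (\sum_sigma \sum_tau (st tau == st sigma)%:R * (at_pos tau o \in future)%:R
   * (g (st tau) / C (st tau))); last first.
  apply: eq_bigr => sigma _; rewrite /cond_future -/(C _) mulrAC -mulrA mulr_suml.
  by apply: eq_bigr => tau _; case: eqP => [->|]; rewrite ?mul0r.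
rewrite exchange_big; apply: eq_bigr => tau _ /=.
under eq_bigr do rewrite -mulrA eq_sym.
by rewrite -mulr_suml -/(C _) mulrCA [C _ * _]mulrC divfK.
Qed.

End RandomOrder.

(** * Expected gain of one window *)

Section WindowGain.
Variables (R : realType) (U : finType) (f : {set U} -> R).
Hypotheses (f_mono : monotone_fun f) (f_sub : submodular f) (f0 : 0 <= f set0).
Variables (B q s m : nat) (pos : nat -> seq U).
Hypothesis pos_uniq : forall j, (j < m)%N -> uniq (pos j).
Hypothesis pos_size : forall j, (j < m)%N -> size (pos j) = s.
Hypothesis pos_disj : forall i j p, (i < m)%N -> (j < m)%N ->
  p \in pos i -> p \in pos j -> i = j.
Variables (t k l : nat) (O : {set U}).
Hypotheses (tm : (t < m)%N) (Ok : (#|O| <= k)%N) (lB : (l.+1 < B)%N) (s_gt0 : (0 < s)%N).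

Let v := value f.
Let state_at (sigma : {perm U}) := stream_state v B q pos sigma t.
Let F := future pos t.
Let W := window pos t.
Let n : R := #|U|%:R.
Let NF : R := #|F|%:R.
Let sR : R := s%:R.
Let low (h : wstate U) := v (nth [::] h.2 l).
Let high (h : wstate U) := v (nth [::] h.2 l.+1).
Let phi (h : wstate U) (o : U) : R := marginal f (enum O) [set y in nth [::] h.2 l] o.
Let inpool (h : wstate U) (o : U) : bool := [:: o] \in h.1.
Let pi (h : wstate U) (o : U) : R := cond_future v B q pos t h o.
Let kap : R := NF / n.
Let theta : R := k%:R * sR / n.
Let inW (sigma : {perm U}) (o : U) : R := (at_pos sigma o \in W)%:R.
Let hits (sigma : {perm U}) : R := \sum_(o in O) inW sigma o.

(* Conditionally on the state [h], this thins the event that [o] arrives in the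
   current window so that its probability is at most [s / n]. *)
Let thin (h : wstate U) (o : U) : R := Num.min 1 (kap / pi h o).

(** How much of this window the analysis attributes to [o]. Pool items are always available and get
    their due share [s / n]. Other items count only on arrival, and simultaneous arrivals split the
    window evenly. Pool shares total at most [theta], so the factor [1 - theta] keeps the sum at
    most 1. *)
Let weight (sigma : {perm U}) (o : U) : R :=
  if inpool (state_at sigma) o then sR / n
  else (1 - theta) * (thin (state_at sigma) o * (inW sigma o / hits sigma)).

Hypothesis theta_le1 : theta <= 1.

Let sR_gt0 : 0 < sR. Proof. by rewrite ltr0n. Qed.

Let sNF : sR <= NF.
Proof.
rewrite /sR /NF ler_nat -(card_window pos_uniq pos_size tm).
exact/subset_leq_card/(window_future pos_disj tm).
Qed.

Let NF_gt0 : 0 < NF. Proof. exact: lt_le_trans sNF. Qed.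

Let NFn : NF + (t * s)%:R = n.
Proof. by rewrite /NF /n -natrD (card_future pos_uniq pos_size pos_disj tm). Qed.

Let n_gt0 : 0 < n. Proof. by rewrite -NFn ltr_pwDl ?ler0n. Qed.

Let kap_gt0 : 0 < kap. Proof. by rewrite divr_gt0. Qed.

Let pi_ge0 h o : 0 <= pi h o. Proof. exact: cond_future_ge0. Qed.

Let thin_ge0 h o : 0 <= thin h o.
Proof. by rewrite /thin le_min ler01 divr_ge0 // ltW. Qed.

Let thin_le1 h o : thin h o <= 1.
Proof. by rewrite /thin ge_min lexx. Qed.

Let pi_thin h o : pi h o * thin h o = Num.min (pi h o) kap.
Proof.
rewrite /thin; have [->|nz] := eqVneq (pi h o) 0.
  by rewrite mul0r min_l // ltW.
by rewrite minr_pMr ?pi_ge0 // mulr1 mulrC divfK.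
Qed.

Let inW01 sigma o : 0 <= inW sigma o <= 1.
Proof. by rewrite /inW ler0n lern1 leq_b1. Qed.

Let theta_ge0 : 0 <= theta.
Proof. by rewrite /theta divr_ge0 ?mulr_ge0 ?ler0n // ltW. Qed.

Let hits_ge o sigma : o \in O -> inW sigma o <= hits sigma.
Proof.
move=> oO; rewrite /hits (bigD1 o) //= lerDl; apply: sumr_ge0 => o' _.
by case/andP: (inW01 sigma o').
Qed.

(** The lower bound is the tangent [1 / x >= 2 - x] at [x = 1]: linear in [hits], so only
    correlations of pairs are needed later. *)
Let share_bounds sigma o : o \in O ->
  0 <= inW sigma o / hits sigma <= inW sigma o /\
  inW sigma o * (2 - hits sigma) <= inW sigma o / hits sigma.
Proof.
move=> oO; have := hits_ge sigma oO; rewrite /inW; case: (_ \in _); last first.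
  by rewrite !mul0r lexx.
move=> h1; have h0 : 0 < hits sigma by apply: lt_le_trans h1.
rewrite !mul1r invr_ge0 (ltW h0) invf_le1 // h1; split => //.
rewrite -[leRHS]mul1r ler_pdivlMr //; have := sqr_ge0 (hits sigma - 1).
move: (hits sigma) => x; nra.
Qed.

Let share_sum sigma : \sum_(o in O) inW sigma o / hits sigma <= 1.
Proof.
rewrite -mulr_suml -/(hits sigma); have [->|nz] := eqVneq (hits sigma) 0.
  by rewrite mul0r.
by rewrite divff.
Qed.

Let weight_ge0 sigma o : o \in O -> 0 <= weight sigma o.
Proof.
move=> oO; rewrite /weight; case: ifP => _; first by rewrite divr_ge0 ?ltW.
have [/andP[h _] _] := share_bounds sigma oO.
by apply: mulr_ge0; [rewrite subr_ge0|exact: mulr_ge0].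
Qed.

Let weight_sum sigma : \sum_(o in O) weight sigma o <= 1.
Proof.
apply: (@le_trans _ _ (\sum_(o in O) (sR / n + (1 - theta) * (inW sigma o / hits sigma)))).
  apply: ler_sum => o oO; rewrite /weight; have [/andP[h _] _] := share_bounds sigma oO.
  have t1 : 0 <= 1 - theta by rewrite subr_ge0.
  case: ifP => _; first by rewrite lerDl mulr_ge0.
  apply: ler_wpDl; first by rewrite divr_ge0 ?ltW.
  by rewrite ler_wpM2l // ler_piMl.
rewrite big_split /= sumr_const -mulr_sumr.
have : (sR / n) *+ #|O| <= theta.
  rewrite -[leLHS]mulr_natl /theta -mulrA ler_wpM2r ?ler_nat //.
  by rewrite divr_ge0 ?ltW.
have := ler_wpM2l (_ : 0 <= 1 - theta) (share_sum sigma); rewrite subr_ge0 => /(_ theta_le1).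
lra.
Qed.

Let window_value sigma := v (nth [::] (stream_state v B q pos sigma t.+1).2 l.+1).

Let low_high sigma : low (state_at sigma) <= high (state_at sigma).
Proof. exact: window_state_mono. Qed.

(** Level [l + 1] never drops below [high], and it reaches [low + phi o] for every [o] of nonzero
    weight, such an [o] being in the window or in the pool. The claim averages these bounds with
    weights of sum at most 1. *)
Let weight_gain sigma :
  high (state_at sigma)
    - \sum_(o in O) weight sigma o * (high (state_at sigma) - low (state_at sigma))
    + \sum_(o in O) weight sigma o * phi (state_at sigma) o <= window_value sigma.
Proof.
set h := state_at sigma; set Y := window_value sigma.
have sB : size h.2 = B by exact: size_window_state.
have Yhigh : high h <= Y by apply: window_step_level_le; rewrite sB.
have Ylow o : o \in O -> weight sigma o != 0 -> low h + phi h o <= Y.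
  move=> oO wo.
  have oc : [:: o] \in [:: [::] & [seq [:: x] | x <- map sigma (pos t)] ++ h.1].
    rewrite inE mem_cat; apply/orP; right; apply/orP.
    move: wo; rewrite /weight /inpool -/h; case: ifP => _; first by right.
    rewrite /inW inE; have [oW _|_] := boolP (at_pos sigma o \in pos t); last first.
      by rewrite mul0r !mulr0 eqxx.
    left; rewrite map_f //; apply/mapP; exists (at_pos sigma o) => //.
    by rewrite /at_pos permKV.
  have lB' : (l.+1 < size h.2)%N by rewrite sB.
  have ext := window_step_extend v (q %| t.+1)%N lB' oc.
  apply: le_trans (ext : _ <= Y).
  have := marginal_le f_mono f_sub [set y in nth [::] h.2 l] (_ : o \in enum O).
  rewrite mem_enum => /(_ oO); rewrite -value_cons -/v -/(phi h o) /low /=.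
  rewrite /v {2}/value; lra.
have key : \sum_(o in O) weight sigma o * (low h + phi h o - high h)
    <= \sum_(o in O) weight sigma o * (Y - high h).
  apply: ler_sum => o oO; have [->|wo] := eqVneq (weight sigma o) 0; first by rewrite !mul0r.
  by rewrite ler_wpM2l ?weight_ge0 // lerD2r Ylow.
have sY : \sum_(o in O) weight sigma o * (Y - high h) <= Y - high h.
  by rewrite -mulr_suml ler_piMl ?weight_sum // subr_ge0.
have E : \sum_(o in O) weight sigma o * (low h + phi h o - high h)
  = - (\sum_(o in O) weight sigma o * (high h - low h))
    + \sum_(o in O) weight sigma o * phi h o.
  rewrite -sumrN -big_split /=; apply: eq_bigr => o _; ring.
move: key sY; rewrite E; lra.
Qed.

Let sum_inW (g : wstate U -> R) o :
  \sum_sigma inW sigma o * g (state_at sigma)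
  = sR / NF * \sum_sigma pi (state_at sigma) o * g (state_at sigma).
Proof.
rewrite -(sum_cond_future v B q pos t g o).
have := hit_window v B q pos_uniq pos_size pos_disj tm g o.
rewrite -/NF -/sR -/W -/F => h; apply: (mulfI (lt0r_neq0 NF_gt0)).
by rewrite [LHS]h mulrA mulrCA divff ?mulr1 // lt0r_neq0.
Qed.

(** Thinning caps the weight of an item outside the pool, given the state, by
    [s / NF * kap = s / n], the share of a pool item. The bound is thus independent of the state. *)
Let loss_le (X : wstate U -> R) : (forall sigma, 0 <= X (state_at sigma)) ->
  \sum_sigma \sum_(o in O) weight sigma o * X (state_at sigma)
  <= theta * \sum_sigma X (state_at sigma).
Proof.
move=> X0; rewrite exchange_big.
have SX : 0 <= \sum_sigma X (state_at sigma) by apply: sumr_ge0.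
apply: (@le_trans _ _ (\sum_(o in O) sR / n * \sum_sigma X (state_at sigma))); last first.
  rewrite sumr_const -[leLHS]mulr_natl mulrA ler_wpM2r // /theta -mulrA.
  by rewrite ler_wpM2r ?ler_nat // divr_ge0 ?ltW.
apply: ler_sum => o oO.
pose g h := (~~ inpool h o)%:R * thin h o * X h.
apply: (@le_trans _ _ (\sum_sigma (sR / n * ((inpool (state_at sigma) o)%:R * X (state_at sigma))
   + inW sigma o * g (state_at sigma)))).
  apply: ler_sum => sigma _; rewrite /weight /g; case: (inpool _ o) => /=.
    by rewrite !mul1r !mul0r mulr0 addr0.
  have [/andP[h0 h1] _] := share_bounds sigma oO.
  have t0 := thin_ge0 (state_at sigma) o.
  rewrite !mul0r mulr0 add0r mul1r [leRHS]mulrA ler_wpM2r //.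
  rewrite mulrCA [leRHS]mulrC ler_wpM2l //.
  apply: le_trans h1; rewrite ler_piMl //; have := theta_ge0; lra.
rewrite big_split /= sum_inW -mulr_sumr.
have -> : sR / n = sR / NF * kap.
  by rewrite /kap mulrA divfK // lt0r_neq0.
rewrite -!(mulrA (sR / NF) kap) -mulrDr; apply: ler_wpM2l; first by rewrite divr_ge0 ?ltW.
rewrite !mulr_sumr -big_split; apply: ler_sum => sigma _ /=.
set h := state_at sigma; rewrite /g; case: (inpool h o); rewrite ?mul1r ?mul0r.
  by rewrite mulr0 addr0.
rewrite mulr0 add0r mulrA pi_thin; apply: ler_wpM2r; first exact: X0.
by rewrite ge_min lexx orbT.
Qed.

Let hits_split sigma o : o \in O ->
  inW sigma o * (2 - hits sigma)
  = inW sigma o - \sum_(o' in O | o' != o) inW sigma o * inW sigma o'.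
Proof.
move=> oO; rewrite -mulr_sumr /hits (bigD1 o) //=.
have -> : inW sigma o * (2 - (inW sigma o + \sum_(i in O | i != o) inW sigma i))
  = 2 * inW sigma o - inW sigma o * inW sigma o
    - inW sigma o * \sum_(i in O | i != o) inW sigma i by ring.
by rewrite -[inW _ _ * inW _ _]natrM mulnb andbb; rewrite -/(inW sigma o); ring.
Qed.

(** Splitting the window costs at most the chance that another optimal item arrives with [o], which
    is at most [s / NF] for each of at most [k] items. *)
Let share_sum_ge (g : wstate U -> R) o : o \in O -> (forall h, 0 <= g h) ->
  (1 - k%:R * sR / NF) * (sR / NF * \sum_sigma pi (state_at sigma) o * g (state_at sigma))
  <= \sum_sigma inW sigma o / hits sigma * g (state_at sigma).
Proof.
move=> oO g0.
apply: (@le_trans _ _ (\sum_sigma inW sigma o * (2 - hits sigma) * g (state_at sigma))); last first.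
  apply: ler_sum => sigma _; rewrite ler_wpM2r //.
  by have [_] := share_bounds sigma oO.
rewrite -sum_inW; set Y := \sum_sigma _ * _.
have -> : \sum_sigma inW sigma o * (2 - hits sigma) * g (state_at sigma)
  = Y - \sum_(o' in O | o' != o) \sum_sigma inW sigma o * inW sigma o' * g (state_at sigma).
  rewrite exchange_big -sumrB; apply: eq_bigr => sigma _.
  by rewrite hits_split // mulrBl mulr_suml.
have Y0 : 0 <= Y.
  by apply: sumr_ge0 => sigma _; rewrite mulr_ge0 //; case/andP: (inW01 sigma o).
rewrite mulrBl mul1r lerD2l lerN2.
apply: (@le_trans _ _ (\sum_(o' in O | o' != o) sR / NF * Y)).
  apply: ler_sum => o' /andP[_ oo']; rewrite mulrAC ler_pdivlMr // mulrC.
  rewrite eq_sym in oo'.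
  exact: (hit_window_pair v B q pos_uniq pos_size pos_disj tm g0 oo').
rewrite sumr_const -[leLHS]mulr_natl mulrA ler_wpM2r // -mulrA.
apply: ler_wpM2r; first by rewrite divr_ge0 ?ltW.
rewrite ler_nat; apply: leq_trans Ok.
by apply: subset_leq_card; apply/subsetP => x; rewrite unfold_in => /andP[].
Qed.

Variables rho eps0 : R.
Hypothesis rho_le1 : rho <= 1.
Hypothesis rhoE : 1 - rho <= (1 - theta) * (1 - k%:R * sR / NF).
Hypothesis rho_ge0 : 0 <= rho.
Hypothesis eps0E : (t * B)%:R <= eps0 * NF.

Let NP : R := #|{perm U}|%:R.

Let phi_ge0 h o : 0 <= phi h o. Proof. exact: marginal_ge0. Qed.

Let enumO : [set y in enum O] = O.
Proof. by apply/setP => y; rewrite inE mem_enum. Qed.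

Let phi_sum_le h : \sum_(o in O) phi h o <= f O.
Proof.
by rewrite -big_enum /= -{2}enumO; apply: sum_marginal_le; rewrite ?enum_uniq.
Qed.

Let phi_sum_ge h : f O - low h <= \sum_(o in O) phi h o.
Proof.
by rewrite -big_enum /= -{1}enumO; apply: sum_marginal_ge; rewrite ?enum_uniq.
Qed.

(** The exchange applied to items outside the pool with [pi < kap]. Since [NF + t s = n], its two
    sides combine to [NF (1 - pi) - t s pi = n (kap - pi)], so it bounds precisely the total
    shortfall of [pi]. *)
Let deficit :
  \sum_(o in O) \sum_sigma (~~ inpool (state_at sigma) o)%:R
     * ((kap - Num.min (pi (state_at sigma) o) kap) * phi (state_at sigma) o)
  <= f O * (t * B)%:R * NP / n.
Proof.
pose psi h o := (~~ inpool h o)%:R * ((pi h o < kap)%R%:R * phi h o).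
have psi0 h o : 0 <= psi h o by rewrite !mulr_ge0 ?ler0n.
have psiP (h : wstate U) o : [:: o] \in h.1 -> psi h o = 0.
  by rewrite /psi /inpool => ->; rewrite mul0r.
have psiS h : \sum_(o in O) psi h o <= f O.
  apply: le_trans (phi_sum_le h); apply: ler_sum => o _.
  rewrite /psi mulrA -natrM mulnb ler_piMl // lern1 leq_b1.
  by [].
have := exchange_past_future v B q pos_uniq pos_size pos_disj tm psi0 psiP psiS.
rewrite -/NF -/F -/NP -/(state_at _) => ex.
rewrite ler_pdivlMr // mulrC mulr_sumr.
have -> : \sum_(o in O) n * \sum_sigma (~~ inpool (state_at sigma) o)%:R
     * ((kap - Num.min (pi (state_at sigma) o) kap) * phi (state_at sigma) o)
  = NF * (\sum_(o in O) \sum_sigma (at_pos sigma o \notin F)%:R * psi (state_at sigma) o)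
    - (t * s)%:R * \sum_(o in O) \sum_sigma (at_pos sigma o \in F)%:R * psi (state_at sigma) o.
  rewrite !mulr_sumr -sumrB; apply: eq_bigr => o _.
  have -> : \sum_sigma (at_pos sigma o \notin F)%:R * psi (state_at sigma) o
    = \sum_sigma psi (state_at sigma) o
      - \sum_sigma (at_pos sigma o \in F)%:R * psi (state_at sigma) o.
    rewrite -sumrB; apply: eq_bigr => sigma _; case: (_ \in F); rewrite /= ?mul1r ?mul0r; ring.
  rewrite (sum_cond_future v B q pos t (fun h => psi h o) o).
  rewrite mulrBr !mulr_sumr -!sumrB; apply: eq_bigr => sigma _.
  rewrite -/(pi _ o) -/(state_at sigma) /psi; set h := state_at sigma.
  have -> : (t * s)%:R = n - NF by rewrite -NFn; ring.
  have kn : kap * n = NF by rewrite /kap divfK // lt0r_neq0.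
  by case: ltP => pk; rewrite -kn /=; ring.
lra.
Qed.

(** Up to the factor [1 - rho], an item outside the pool contributes [s / NF * min pi kap] times its
    marginal. Replacing the minimum by [kap] costs [deficit], at most an [eps0] fraction of [f O],
    and the marginals sum to at least [f O - low]. *)
Let gain_ge :
  (1 - rho) * (sR / n) * (NP * (1 - eps0) * f O - \sum_sigma low (state_at sigma))
  <= \sum_sigma \sum_(o in O) weight sigma o * phi (state_at sigma) o.
Proof.
pose G o h := (~~ inpool h o)%:R * (thin h o * phi h o).
have G0 o h : 0 <= G o h by rewrite !mulr_ge0 ?ler0n.
have rho1 : 0 <= 1 - rho by rewrite subr_ge0.
have sn0 : 0 <= sR / n by rewrite divr_ge0 ?ltW.
have sNF0 : 0 <= sR / NF by rewrite divr_ge0 ?ltW.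
have snE : sR / n = sR / NF * kap by rewrite /kap mulrA divfK // lt0r_neq0.
have step1 o : o \in O -> (1 - rho) * (sR / NF) * (\sum_sigma (kap * phi (state_at sigma) o
      - (~~ inpool (state_at sigma) o)%:R
        * ((kap - Num.min (pi (state_at sigma) o) kap) * phi (state_at sigma) o)))
    <= \sum_sigma weight sigma o * phi (state_at sigma) o.
  move=> oO.
  have -> : \sum_sigma weight sigma o * phi (state_at sigma) o
    = \sum_sigma (inpool (state_at sigma) o)%:R * (sR / n * phi (state_at sigma) o)
      + (1 - theta) * \sum_sigma inW sigma o / hits sigma * G o (state_at sigma).
    rewrite mulr_sumr -big_split; apply: eq_bigr => sigma _ /=; rewrite /weight /G.
    by case: (inpool _ o) => /=; ring.
  have t1 : 0 <= 1 - theta by rewrite subr_ge0.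
  have sg := ler_wpM2l t1 (share_sum_ge oO (G0 o)); rewrite mulrA in sg.
  set S := \sum_sigma pi _ o * G o _ in sg.
  have S0 : 0 <= S by apply: sumr_ge0 => sigma _; rewrite mulr_ge0.
  have sg2 : (1 - rho) * (sR / NF * S) <= (1 - theta) *
      \sum_sigma inW sigma o / hits sigma * G o (state_at sigma).
    by apply: le_trans sg; rewrite ler_wpM2r // mulr_ge0.
  apply: (@le_trans _ _ (\sum_sigma (inpool (state_at sigma) o)%:R
      * ((1 - rho) * (sR / NF) * (kap * phi (state_at sigma) o)) + (1 - rho) * (sR / NF * S))).
    rewrite /S !mulr_sumr -big_split le_eqVlt; apply/orP; left; apply/eqP.
    apply: eq_bigr => sigma _ /=; rewrite /G; set h := state_at sigma.
    have := pi_thin h o; case: (inpool h o) => /= pt; first by ring.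
    rewrite !mul0r !mul1r mulrA in pt *; rewrite -pt; ring.
  apply: lerD => //; apply: ler_sum => sigma _; rewrite ler_wpM2l ?ler0n //.
  rewrite snE -[leLHS]mulrA [_ / NF * (kap * _)]mulrA ler_piMl //; last by move: rho_ge0; lra.
  by apply: mulr_ge0; [apply: mulr_ge0; rewrite // ltW | exact: phi_ge0].
rewrite exchange_big; apply: le_trans (ler_sum _ step1).
rewrite -mulr_sumr snE [(1 - rho) * (_ * kap)]mulrA -[leLHS]mulrA.
apply: ler_wpM2l; first exact: mulr_ge0.
under [leRHS]eq_bigr do rewrite sumrB.
rewrite sumrB; have df := deficit.
have : kap * (NP * f O - \sum_sigma low (state_at sigma)) <=
    \sum_(o in O) \sum_sigma kap * phi (state_at sigma) o.
  rewrite [leRHS]exchange_big /=.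
  apply: (@le_trans _ _ (\sum_sigma kap * (f O - low (state_at sigma)))).
    by rewrite -mulr_sumr sumrB sumr_const -mulr_natl.
  by apply: ler_sum => sigma _; rewrite -mulr_sumr ler_wpM2l ?phi_sum_ge // ltW.
have : f O * (t * B)%:R * NP / n <= kap * (NP * eps0 * f O).
  have -> : kap * (NP * eps0 * f O) = (eps0 * NF) * (f O * NP / n) by rewrite /kap; ring.
  rewrite (_ : f O * (t * B)%:R * NP / n = (t * B)%:R * (f O * NP / n)); last by ring.
  by rewrite ler_wpM2r // !mulr_ge0 ?invr_ge0 ?ler0n ?(f_ge0 f_mono f0).
lra.
Qed.

Lemma window_gain :
  (1 - theta) * \sum_sigma high (state_at sigma) + theta * \sum_sigma low (state_at sigma)
  + (1 - rho) * (sR / n) * (NP * (1 - eps0) * f O - \sum_sigma low (state_at sigma))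
  <= \sum_sigma window_value sigma.
Proof.
apply: le_trans (ler_sum _ (fun sigma _ => weight_gain sigma)).
rewrite big_split /= sumrB; have := gain_ge.
have := @loss_le (fun h => high h - low h); rewrite sumrB => /(_ _)/= ll.
have : forall sigma, 0 <= high (state_at sigma) - low (state_at sigma).
  by move=> sigma; rewrite subr_ge0.
by move/ll; lra.
Qed.

End WindowGain.

(** * Growth over a block and over all blocks *)

Section BlockGrowth.
Variables (R : realType) (a : nat -> nat -> R) (b q : nat) (theta c r V : R).
Hypotheses (theta01 : 0 <= theta <= 1) (c_gt0 : 0 < c) (r_ge0 : 0 <= r).
Hypothesis a_time : forall t l, (t < q)%N -> (l <= b)%N -> a t l <= a t.+1 l.
Hypothesis a_level : forall t l l', (l <= l')%N -> (l' <= b)%N -> a t l <= a t l'.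
Hypothesis a_start : forall l, (l <= b)%N -> a 0 l = a 0 b.
Hypothesis a_gain : forall t l, (t < q)%N -> (l < b)%N ->
  (1 - theta) * a t l.+1 + theta * a t l + theta * r * (V - a t l) <= a t.+1 l.+1.

(* With [X] binomial of parameters [i] and [theta], this is the expectation of
   [l - ((l - X)^2 / c + c) / 2], a lower bound on that of [min l X]. *)
Definition progress (i l : nat) : R :=
  l%:R - ((l%:R - i%:R * theta) ^+ 2 + i%:R * theta * (1 - theta) + c ^+ 2) / (2 * c).

Lemma progress0 l : progress 0 l <= 0.
Proof.
rewrite /progress !mul0r subr0 addr0 subr_le0 ler_pdivlMr ?mulr_gt0 //.
by have := sqr_ge0 (l%:R - c); nra.
Qed.

Lemma progress_level0 i : progress i 0 <= 0.
Proof.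
rewrite /progress sub0r oppr_le0; apply: divr_ge0; last by rewrite mulr_ge0 // ltW.
have t0 : 0 <= theta by case/andP: theta01.
have t1 : 0 <= 1 - theta by case/andP: theta01; rewrite subr_ge0.
by rewrite !addr_ge0 ?sqr_ge0 ?mulr_ge0 ?ler0n.
Qed.

(** Condition on one trial: a success contributes one unit and leaves [l] against the other [i]
    trials. *)
Lemma progress_rec i l : progress i.+1 l.+1
  = (1 - theta) * progress i l.+1 + theta * (1 + progress i l).
Proof.
have c0 : c != 0 by rewrite gt_eqF.
by rewrite /progress -[i.+1]addn1 -[l.+1]addn1 !natrD; field.
Qed.


Let a_final t l : (t <= q)%N -> (l <= b)%N -> a t l <= a q b.
Proof.
move=> tq lb; apply: le_trans (a_level _ lb (leqnn b)) _.
suff h d : (t + d <= q)%N -> a t b <= a (t + d)%N b.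
  by have := h (q - t)%N; rewrite subnKC // => /(_ (leqnn _)).
elim: d => [|d IH]; first by rewrite addn0.
rewrite addnS => tdq; apply: le_trans (IH (ltnW tdq)) _; exact: a_time.
Qed.

(** No [a t l] exceeds [a q b], so [D] bounds [r * (V - a t l)] from below throughout the block.
    Then [a] satisfies the recursion of [progress] scaled by [D], as an inequality, and starts above
    it. *)
Lemma block_growth : 0 <= V - a q b ->
  a 0 b + r * (V - a q b) * progress q b <= a q b.
Proof.
move=> D0; set D := r * (V - a q b).
have D0' : 0 <= D by rewrite mulr_ge0.
case/andP: theta01 => t0 t1.
suff h i l : (i <= q)%N -> (l <= b)%N -> a 0 b + D * progress i l <= a i l by exact: h.
elim: i l => [|i IH] l iq lb.
  rewrite a_start //; have := progress0 l; nra.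
case: l lb => [|l] lb.
  have := progress_level0 i.+1.
  have : a 0 b <= a i.+1 0%N.
    rewrite -(a_start (leq0n b)).
    have hh d : (d <= q)%N -> a 0 0%N <= a d 0%N.
      by elim: d => // d IHd dq; apply: le_trans (IHd (ltnW dq)) _; exact: a_time.
    exact: hh.
  nra.
apply: le_trans (a_gain iq lb); rewrite progress_rec.
have h1 := IH l.+1 (ltnW iq) lb; have h2 := IH l (ltnW iq) (ltnW lb).
have h3 : D <= r * (V - a i l).
  by rewrite /D ler_wpM2l // lerD2l lerN2 a_final // ltnW.
have h4 : 0 <= (1 - theta) * (a i l.+1 - (a 0 b + D * progress i l.+1)).
  by rewrite mulr_ge0 // subr_ge0.
have h5 : 0 <= theta * (a i l - (a 0 b + D * progress i l)).
  by rewrite mulr_ge0 // subr_ge0.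
have h6 : 0 <= theta * (r * (V - a i l) - D) by rewrite mulr_ge0 // subr_ge0.
move: h4 h5 h6; rewrite !mulrBr !mulrDr; lra.
Qed.

End BlockGrowth.

Lemma contraction_bound (R : realType) (d : nat -> R) (V y : R) K :
  0 <= V -> 0 <= y -> d 0%N <= V ->
  (forall i, (i < K)%N -> 0 <= d i.+1 -> d i.+1 * (1 + y) <= d i) ->
  d K <= V * expR (- (K%:R * (y / (1 + y)))).
Proof.
move=> V0 y0 d0; elim: K => [|K IH] dK.
  by rewrite mul0r oppr0 expR0 mulr1.
have {}IH := IH (fun i iK => dK i (ltnW iK)).
have y1 : 0 < 1 + y by lra.
have [dn|dp] := ltP (d K.+1) 0.
  by apply: ltW (lt_le_trans dn _); rewrite mulr_ge0 ?expR_ge0.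
have h := dK K (ltnSn K) dp.
(* [1 / (1 + y)] equals [1 - y / (1 + y)], and [1 + x <= expR x]. *)
have e1 : (1 + y)^-1 <= expR (- (y / (1 + y))).
  apply: le_trans (expR_ge1Dx _); rewrite le_eqVlt; apply/orP; left; apply/eqP.
  by field; rewrite gt_eqF.
rewrite -natr1 mulrDl mul1r opprD expRD mulrA.
apply: (@le_trans _ _ (d K * (1 + y)^-1)); first by rewrite ler_pdivlMr.
have dK0 : 0 <= d K by apply: le_trans h; rewrite mulr_ge0 // ltW.
apply: (@le_trans _ _ (d K * expR (- (y / (1 + y))))); first by rewrite ler_wpM2l.
by rewrite ler_wpM2r ?expR_ge0.
Qed.

(** On this range [expR z <= 1 / (1 - z) <= 1 + 2 z], and [2 * expR (-1) <= 1] absorbs the factor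
    2. *)
Lemma expR_shift (R : realType) (z : R) : 0 <= z <= 1 / 2 ->
  expR (-1 + z) <= expR (-1) + z.
Proof.
case/andP => z0 z1.
have em : 2 * expR (-1) <= 1 :> R.
  rewrite expRN -ler_pdivlMr ?invr_gt0 ?expR_gt0 // mul1r invrK.
  by apply: le_trans (expR_ge1Dx _); lra.
have ez : expR z * (1 - z) <= 1.
  have zN : expR z * expR (- z) = 1 by rewrite -expRD subrr expR0.
  by rewrite -[leRHS]zN ler_wpM2l ?expR_ge0 // expR_ge1Dx.
rewrite expRD; have := expR_ge0 (-1 : R); move: (expR (-1)) em => e em e0.
have : expR z <= 1 + 2 * z.
  have : 0 < expR z by exact: expR_gt0.
  move: (expR z) ez => w; nra.
move: (expR z) => w; nra.
Qed.

(** Without rounding [K y] is [(N - 1) (N - 2) ^ 2 / N ^ 3 >= 1 - 5 / N]. The rounding of [K] costs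
    [y] and the passage to [y / (1 + y)] costs [K y ^ 2]; each is at most [N ^ 2 / k]. *)
Lemma block_exponent (R : realType) (N k K : R) : 20 <= N -> 8 * N ^+ 2 <= k ->
  (N - 1) * k / N ^+ 3 - 1 <= K -> K <= k / N ^+ 2 -> 0 <= K ->
  let y := (N - 2) ^+ 2 / k in
  1 - (5 / N + 2 * N ^+ 2 / k) <= K * (y / (1 + y)).
Proof.
move=> N20 Nk Klo Khi K0 /=; set y := (N - 2) ^+ 2 / k.
have N0 : 0 < N by lra.
have k0 : 0 < k by apply: lt_le_trans Nk; rewrite mulr_gt0 // exprn_gt0.
have N2 : 0 < N ^+ 2 by rewrite exprn_gt0.
have y0 : 0 <= y by apply: divr_ge0; [exact: sqr_ge0 | exact: ltW].
have yhi : y <= N ^+ 2 / k.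
  apply: ler_wpM2r; first by rewrite invr_ge0 ltW.
  by nra.
have h1 : y - y ^+ 2 <= y / (1 + y).
  by rewrite ler_pdivlMr; [nra | lra].
have h2 : K * y ^+ 2 <= N ^+ 2 / k.
  apply: (@le_trans _ _ (k / N ^+ 2 * (N ^+ 2 / k) ^+ 2)).
    apply: ler_pM => //; first exact: sqr_ge0.
    by apply: lerXn2r; rewrite ?nnegrE // divr_ge0 // ltW.
  rewrite le_eqVlt; apply/orP; left; apply/eqP; field.
  by rewrite !gt_eqF.
have h3 : 1 - 5 / N - N ^+ 2 / k <= K * y.
  apply: (@le_trans _ _ (((N - 1) * k / N ^+ 3 - 1) * y)); last by rewrite ler_wpM2r.
  rewrite mulrBl mul1r; apply: lerB => //.
  have -> : (N - 1) * k / N ^+ 3 * y = (N - 1) * (N - 2) ^+ 2 / N ^+ 3.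
    by rewrite /y; field; rewrite !gt_eqF.
  rewrite ler_pdivlMr ?exprn_gt0 //.
  have -> : (1 - 5 / N) * N ^+ 3 = N ^+ 3 - 5 * N ^+ 2 by field; rewrite gt_eqF.
  by nra.
have h4 : K * (y - y ^+ 2) <= K * (y / (1 + y)) by rewrite ler_wpM2l.
move: h4; rewrite mulrBr; lra.
Qed.

Lemma leftover_bound (n w x N : nat) : (0 < N)%N ->
  (w + x = n)%N -> (x * N <= N.-1 * n)%N -> (n <= N * w)%N.
Proof.
case: N => // M _ <- h; rewrite -(leq_add2r (M * (w + x))) -mulSn mulnDr leq_add2l.
by rewrite mulnC.
Qed.

(** * Choice of parameters and ratio for long streams *)

Section LargeStream.
Variables (R : realType) (U : finType) (f : {set U} -> R) (N k : nat).
Hypotheses (f_mono : monotone_fun f) (f_sub : submodular f) (f0 : 0 <= f set0).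
Hypotheses (N20 : (20 <= N)%N) (k_gt0 : (0 < k)%N) (large : (k * N ^ 7 <= #|U|)%N).

(** This [s] makes [theta] about [1 / N ^ 2], so two optimal items rarely share a window, and
    [theta * q] about [b]. The [K] blocks commit at most [K * b <= k] items and use at most the
    fraction [1 - 1 / N] of the stream, so the future always keeps at least [n / N] positions. *)
Let s := (#|U| %/ (k * N ^ 2))%N.
Let K := (N.-1 * k %/ N ^ 3)%N.
Let q := (N ^ 4)%N.
Let m := (K * q)%N.
Let b := (N ^ 2)%N.
Let pos j := take s (drop (j * s) (enum U)).
Let v := value f.

Let s_large : (N ^ 5 <= s)%N.
Proof.
rewrite leq_divRL ?muln_gt0 ?k_gt0 ?expn_gt0 ?(leq_trans _ N20) //.
by apply: leq_trans large; rewrite mulnCA -expnD.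
Qed.

Let s_upper : (k * s * N ^ 2 <= #|U|)%N.
Proof. by have := leq_trunc_div #|U| (k * N ^ 2); rewrite -/s; lia. Qed.

Let s_lower : (#|U| < k * N ^ 2 * s.+1)%N.
Proof.
rewrite [X in (_ < X)%N]mulnC; apply: ltn_ceil.
by rewrite muln_gt0 k_gt0 expn_gt0 (leq_trans _ N20).
Qed.

Let K_upper : (K * N ^ 3 <= N.-1 * k)%N.
Proof. exact: leq_trunc_div. Qed.

Let K_lower : (N.-1 * k < N ^ 3 * K.+1)%N.
Proof. by rewrite [X in (_ < X)%N]mulnC; apply: ltn_ceil; rewrite expn_gt0 (leq_trans _ N20). Qed.

Let used : (m * s * N <= N.-1 * #|U|)%N.
Proof.
have -> : (m * s * N = K * N ^ 3 * (s * N ^ 2))%N.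
  by rewrite /m /q; ring.
apply: (@leq_trans (N.-1 * k * (s * N ^ 2))); first by rewrite leq_mul2r K_upper orbT.
by rewrite -mulnA leq_mul2l mulnA s_upper orbT.
Qed.

Let ms_le : (m * s <= #|U|)%N.
Proof.
rewrite -(@leq_pmul2r N) ?(leq_trans _ N20) //; apply: leq_trans used _.
by rewrite mulnC leq_mul2l leq_pred orbT.
Qed.

Let pos_uniq j : (j < m)%N -> uniq (pos j).
Proof. by move=> _; rewrite take_uniq // drop_uniq // enum_uniq. Qed.

Let pos_size j : (j < m)%N -> size (pos j) = s.
Proof.
move=> jm; rewrite size_takel // size_drop -cardE.
have : (j.+1 * s <= m * s)%N by rewrite leq_mul2r jm orbT.
move/leq_trans/(_ ms_le); rewrite mulSn => h.
by have := leq_sub2r (j * s) h; rewrite addnK.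
Qed.

Let pos_index j p : p \in pos j -> (j * s <= index p (enum U) < j * s + s)%N.
Proof.
case/(nthP p) => i; rewrite size_take_min leq_min size_drop ltn_subRL => /andP[is_ ie] <-.
by rewrite nth_take // nth_drop index_uniq ?enum_uniq // leq_addr ltn_add2l.
Qed.

Let pos_disj i j p : (i < m)%N -> (j < m)%N -> p \in pos i -> p \in pos j -> i = j.
Proof.
move=> _ _ /pos_index/andP[i1 i2] /pos_index/andP[j1 j2].
have h1 : (i * s < j.+1 * s)%N by rewrite mulSn addnC (leq_ltn_trans i1).
have h2 : (j * s < i.+1 * s)%N by rewrite mulSn addnC (leq_ltn_trans j1).
by move: h1 h2; rewrite !ltn_mul2r !ltnS => /andP[_ ij] /andP[_ ji]; apply/eqP; rewrite eqn_leq ij.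
Qed.

Let NP : R := #|{perm U}|%:R.
Let a t l := (\sum_sigma v (nth [::] (stream_state v b.+1 q pos sigma t).2 l)) / NP.
Let NR : R := N%:R.
Let kR : R := k%:R.
Let n : R := #|U|%:R.
Let theta : R := kR * s%:R / n.
Let V : R := (1 - NR^-1) * OPT f k.
Let rate : R := (1 - 2 / NR) / kR.

Let NP_gt0 : 0 < NP.
Proof. by rewrite ltr0n; apply/card_gt0P; exists 1%g. Qed.
Let NR20 : 20 <= NR. Proof. by rewrite (ler_nat _ 20). Qed.
Let NR_gt0 : 0 < NR. Proof. by have := NR20; lra. Qed.
Let kR_gt0 : 0 < kR. Proof. by rewrite ltr0n. Qed.
Let kn : kR * NR ^+ 7 <= n.
Proof. by rewrite /kR /NR /n -natrX -natrM ler_nat. Qed.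
Let n_gt0 : 0 < n.
Proof. by apply: lt_le_trans kn; rewrite mulr_gt0 // exprn_gt0. Qed.

Let theta_bounds : 0 <= theta /\ theta * NR ^+ 2 <= 1.
Proof.
split; first by rewrite divr_ge0 ?mulr_ge0 ?ler0n.
rewrite /theta mulrAC ler_pdivrMr // mul1r /kR /NR /n -natrX -!natrM ler_nat.
exact: s_upper.
Qed.

Let theta_le1 : theta <= 1.
Proof. by have [t0 t1] := theta_bounds; have := NR20; nra. Qed.

Let future_large t : (t < m)%N -> n <= NR * #|future pos t|%:R.
Proof.
move=> tm; rewrite /n /NR -natrM ler_nat.
apply: (leftover_bound _ (card_future pos_uniq pos_size pos_disj tm)).
  exact: leq_trans N20.
by apply: leq_trans used; rewrite !leq_mul2r ltnW ?orbT.
Qed.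

Let a_gain t l : (t < m)%N -> (l < b)%N ->
  (1 - theta) * a t l.+1 + theta * a t l + theta * rate * (V - a t l) <= a t.+1 l.+1.
Proof.
move=> tm lb; have [O [Ok OE]] := OPT_attained f k.
have s0 : (0 < s)%N by apply: leq_trans s_large; rewrite expn_gt0 (leq_trans _ N20).
have FL := future_large tm; set NF : R := #|future pos t|%:R in FL.
have [th0 thN] := theta_bounds.
have NF0 : 0 < NF by rewrite -(pmulr_rgt0 _ NR_gt0) (lt_le_trans n_gt0).
have ksn : kR * s%:R * NR ^+ 2 <= n.
  by rewrite /kR /NR /n -natrX -!natrM ler_nat s_upper.
have ksN : kR * s%:R * NR <= NF.
  by rewrite -(ler_pM2l NR_gt0); apply: le_trans FL; move: ksn; nra.
have ks0 : 0 <= kR * s%:R by rewrite mulr_ge0 ?ler0n.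
have Ninv : NR^-1 * NR = 1 by rewrite mulVf // gt_eqF.
have Ni0 : 0 < NR^-1 by rewrite invr_gt0.
have rho1 : 2 / NR <= 1 by rewrite ler_pdivrMr //; have := NR20; lra.
have rho0 : 0 <= 2 / NR by rewrite divr_ge0 // ltW.
have th1 : theta <= NR^-1.
  by rewrite -[leRHS]mul1r ler_pdivlMr //; have := NR20; nra.
have ksi : kR * s%:R / NF <= NR^-1 by rewrite ler_pdivrMr // [leRHS]mulrC ler_pdivlMr.
have ksi0 : 0 <= kR * s%:R / NF by rewrite divr_ge0 // ltW.
(* One [1 / N] pays for [theta], the other for collisions of optimal items in a window. *)
have rhoE : 1 - 2 / NR <= (1 - theta) * (1 - kR * s%:R / NF).
  by move: th1 ksi ksi0; move: (kR * s%:R / NF) => u; nra.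
(* Here the lower bound on the length of the stream enters: a window has at most [N ^ 2 + 1] pivotal
   positions but at least [N ^ 5] positions, and the past is at most [N] times the future. *)
have tB : (t * b.+1)%:R <= NR^-1 * NF.
  rewrite mulrC ler_pdivlMr // natrM.
  have ts : (t * s <= #|U|)%N.
    by apply: leq_trans ms_le; rewrite leq_mul2r ltnW ?orbT.
  have ts2 : t%:R * NR ^+ 5 <= NR * NF.
    apply: le_trans FL; apply: le_trans (_ : (t * s)%:R <= n); last by rewrite ler_nat.
    by rewrite natrM ler_wpM2l ?ler0n // /NR -natrX ler_nat.
  have bE : b.+1%:R = NR ^+ 2 + 1 :> R by rewrite -addn1 natrD natrX.
  rewrite bE; have t0 : 0 <= t%:R :> R by rewrite ler0n.
  have ts3 : t%:R * NR ^+ 4 <= NF.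
    by rewrite -(ler_pM2l NR_gt0); apply: le_trans ts2; rewrite mulrCA -exprS.
  apply: le_trans ts3; rewrite -mulrA ler_wpM2l //.
  by have := NR20; nra.
have := @window_gain R U f f_mono f_sub f0 b.+1 q s m pos pos_uniq pos_size pos_disj
  t k l O tm Ok lb s0 theta_le1 (2 / NR) NR^-1 rho1 rhoE rho0 tB.
rewrite -/NP -/v OE -/n -/kR -/theta => wg.
rewrite /a /= ler_pdivlMr //.
have rE : theta * rate = (1 - 2 / NR) * (s%:R / n).
  by rewrite /theta /rate; field; rewrite !gt_eqF.
apply: le_trans wg; rewrite rE /V; set A := \sum_sigma _; set A' := \sum_sigma _.
rewrite le_eqVlt; apply/orP; left; apply/eqP; field.
by rewrite !gt_eqF.
Qed.

Let a_time t l : (l <= b)%N -> a t l <= a t.+1 l.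
Proof.
move=> lb; apply: ler_wpM2r; first by rewrite invr_ge0 ltW.
apply: ler_sum => sigma _.
by apply: window_step_level_le; rewrite size_window_state.
Qed.

Let a_level t l l' : (l <= l')%N -> (l' <= b)%N -> a t l <= a t l'.
Proof.
move=> ll lb; apply: ler_wpM2r; first by rewrite invr_ge0 ltW.
apply: ler_sum => sigma _.
exact: window_state_mono.
Qed.

Let progress_large : NR ^+ 2 - 2 * NR <= progress theta NR q b.
Proof.
have [th0 thN] := theta_bounds.
rewrite /progress; set x := q%:R * theta.
have qE : q%:R = NR ^+ 4 :> R by rewrite natrX.
have bE : b%:R = NR ^+ 2 :> R by rewrite natrX.
have xhi : x <= NR ^+ 2.
  rewrite /x qE (_ : 4 = 2 + 2)%N // exprD -mulrA ler_piMr ?sqr_ge0 //.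
  by rewrite mulrC.
(* Rounding [s] down lowers [x] by at most [k N ^ 4 / n <= 1]. *)
have xlo : NR ^+ 2 - 1 <= x.
  have sl : n <= kR * NR ^+ 2 * (s%:R + 1).
    by rewrite /n /kR /NR natr1 -natrX -!natrM ler_nat ltnW.
  rewrite /x qE /theta mulrA ler_pdivlMr //.
  have : kR * NR ^+ 4 <= n.
    apply: le_trans kn; rewrite ler_pM2l //; apply: ler_weXn2l => //.
    by have := NR20; lra.
  have N2 : 0 <= NR ^+ 2 by rewrite sqr_ge0.
  have := ler_wpM2l N2 sl.
  have -> : NR ^+ 2 * (kR * NR ^+ 2 * (s%:R + 1)) = NR ^+ 4 * (kR * s%:R) + kR * NR ^+ 4 by ring.
  lra.
have sq : (b%:R - x) ^+ 2 <= 1.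
  have u01 : 0 <= NR ^+ 2 - x <= 1 by lra.
  by rewrite bE; move: (NR ^+ 2 - x) u01 => u; nra.
rewrite lerBrDr -lerBrDl bE ler_pdivrMr ?mulr_gt0 //.
have x0 : 0 <= x by rewrite mulr_ge0 ?ler0n.
rewrite bE in sq; have := NR20; move: sq xhi; nra.
Qed.

Let y : R := (NR - 2) ^+ 2 / kR.

Let block_contraction i : (i < K)%N -> 0 <= V - a (i.+1 * q) b ->
  (V - a (i.+1 * q) b) * (1 + y) <= V - a (i * q) b.
Proof.
move=> iK; rewrite mulSn addnC => D0.
have [th0 thN] := theta_bounds.
have r0 : 0 <= rate.
  rewrite divr_ge0 ?(ltW kR_gt0) // subr_ge0 ler_pdivrMr //; have := NR20; lra.
have h : a (i * q + 0) b + rate * (V - a (i * q + q) b) * progress theta NR q b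
    <= a (i * q + q) b.
  apply: (@block_growth R (fun t l => a (i * q + t) l) b q theta NR rate V) => //.
  - by rewrite th0 theta_le1.
  - by move=> t l _ lb; rewrite addnS; exact: a_time.
  - by move=> t l l'; exact: a_level.
  - move=> l lb; congr (_ / _); apply: eq_bigr => sigma _; congr (v _).
    by rewrite addn0 [LHS]window_state_block //= dvdn_mull.
  - move=> t l tq lb; rewrite addnS; apply: a_gain => //.
    apply: (@leq_trans (i.+1 * q)); first by rewrite mulSn addnC ltn_add2r.
    by rewrite leq_mul2r iK orbT.
rewrite addn0 in h; rewrite mulrDr mulr1.
have yE : y = rate * (NR ^+ 2 - 2 * NR).
  by rewrite /y /rate; field; rewrite !gt_eqF.
have : (V - a (i * q + q) b) * y <= rate * (V - a (i * q + q) b) * progress theta NR q b.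
  rewrite yE mulrCA mulrA ler_wpM2l //; exact: mulr_ge0.
lra.
Qed.

Lemma large_stream_ratio : (8 * N ^ 2 <= k)%N ->
  (1 - expR (-1) - 6 / NR - 2 * NR ^+ 2 / kR) * OPT f k <= a m b.
Proof.
move=> kN.
have [O [Ok OE]] := OPT_attained f k.
have O0 : 0 <= OPT f k by rewrite -OE f_ge0.
have Ni0 : 0 < NR^-1 by rewrite invr_gt0.
have Ni1 : NR^-1 <= 1 by rewrite invf_le1 //; have := NR20; lra.
have V0 : 0 <= V by rewrite mulr_ge0 // subr_ge0.
have y0 : 0 <= y by rewrite divr_ge0 ?sqr_ge0 // ltW.
have d0 : V - a (0 * q) b <= V.
  rewrite lerBlDr lerDl mul0n divr_ge0 ?(ltW NP_gt0) //; apply: sumr_ge0 => sigma _.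
  exact: f_ge0.
have := contraction_bound V0 y0 d0 block_contraction; rewrite -/m => fin.
have kN' : 8 * NR ^+ 2 <= kR by rewrite /NR /kR -natrX -natrM ler_nat.
have KN3 : 0 < NR ^+ 3 by rewrite exprn_gt0.
have predN : N.-1%:R = NR - 1 :> R.
  by rewrite -subn1 natrB // (leq_trans _ N20).
have Klo : (NR - 1) * kR / NR ^+ 3 - 1 <= K%:R.
  rewrite lerBlDr ler_pdivrMr // natr1 -predN /NR /kR -natrX -!natrM ler_nat.
  by apply: ltnW; rewrite [X in (_ < X)%N]mulnC.
have Khi : K%:R <= kR / NR ^+ 2.
  rewrite ler_pdivlMr ?exprn_gt0 // /NR /kR -natrX -natrM ler_nat.
  rewrite -(@leq_pmul2r N) ?(leq_trans _ N20) // -mulnA -expnSr.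
  by apply: leq_trans K_upper _; rewrite mulnC leq_mul2l leq_pred orbT.
have ex := block_exponent NR20 kN' Klo Khi (ler0n _ _); rewrite /= -/y in ex.
set z := 5 / NR + 2 * NR ^+ 2 / kR in ex.
(* Together with [5 / N <= 1 / 4] this puts [z] in the range of [expR_shift]; it is the reason for
   [8 * N ^ 2 <= k]. *)
have z1 : 2 * NR ^+ 2 / kR <= 1 / 4 by rewrite ler_pdivrMr //; lra.
have z0 : 0 <= 2 * NR ^+ 2 / kR by rewrite divr_ge0 ?mulr_ge0 ?sqr_ge0 ?ltW.
have z2 : 5 / NR <= 1 / 4 by rewrite ler_pdivrMr //; have := NR20; lra.
have z3 : 0 <= 5 / NR by rewrite divr_ge0 ?ltW.
have ez : expR (- (K%:R * (y / (1 + y)))) <= expR (-1) + z.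
  apply: le_trans (expR_shift (_ : 0 <= z <= 1 / 2)); last by rewrite /z; lra.
  by rewrite ler_expR; lra.
have fin2 : V * (1 - expR (-1) - z) <= a m b.
  have := ler_wpM2l V0 ez; move: fin; rewrite /= !mulrBr !mulrDr; lra.
apply: le_trans fin2.
have e12 : expR (-1) <= 1 / 2 :> R.
  rewrite expRN div1r lef_pV2 ?posrE ?expR_gt0 //.
  by apply: le_trans (expR_ge1Dx _); lra.
have e0 : 0 <= expR (-1) :> R by exact: expR_ge0.
(* [5 / N] comes from the exponent, [1 / N] from the loss of [V] against OPT. *)
have -> : 6 / NR = 5 / NR + NR^-1 by field; rewrite gt_eqF.
rewrite /V; have w0 : 0 <= 1 - expR (-1) - z by rewrite /z; lra.
have w1 : 1 - expR (-1) - z <= 1 by rewrite /z; lra.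
rewrite [leRHS]mulrAC ler_wpM2r //.
have : NR^-1 * (1 - expR (-1) - z) <= NR^-1 by rewrite ler_piMr // ltW.
rewrite mulrBl mul1r /z; lra.
Qed.

End LargeStream.

(** The threshold [k * N ^ 7] gives windows of at least [N ^ 5] items. Short streams have no window
    and [k] final greedy rounds; their [blen] is 1 to stay positive. The [N ^ 2 + 1] levels are
    numbered from 0 to [N ^ 2]. *)
Definition stream_params (N n k : nat) : params :=
  if (n < k * N ^ 7)%N then Params true 0 0 1 1 k
  else Params false (n %/ (k * N ^ 2)) (N.-1 * k %/ N ^ 3 * N ^ 4) (N ^ 4) (N ^ 2).+1 0.

Definition query_constant (N : nat) : nat :=
  let A := (N ^ 2).+1 in
  (2 * A + (A * A * N ^ 2 + A * (2 * A + 2)) * N ^ 2 + N ^ 7)%N.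

(** Used with [b = N ^ 2], [M = N ^ 7], [K] blocks and [w] windows; the summands are pool, levels
    and candidates. *)
Lemma memory_arith (b K w k M : nat) : (10 <= b)%N -> (0 < k)%N -> (K * b <= k)%N ->
  (w <= k * b)%N -> (b * b * b <= M)%N ->
  (b.+1 * w + b.+1 * (b * K + b.+1) + b.+1 <= 4 * M * k)%N.
Proof.
move=> b10 k0 Kb wk bM.
have h1 : (b.+1 * w <= 2 * b * (k * b))%N by apply: leq_mul => //; lia.
have h2 : (b.+1 * (b * K + b.+1) <= 2 * b * (k + 2 * b))%N by apply: leq_mul; lia.
have h3 : (b * b * b * k <= M * k)%N by rewrite leq_mul2r bM orbT.
have h4 : (10 * (b * b * k) <= b * (b * b * k))%N by rewrite leq_mul2r b10 orbT.
have h5 : (b * b <= b * b * k)%N by rewrite leq_pmulr.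
have h6 : (b <= b * b)%N by rewrite leq_pmulr //; lia.
have h7 : (b * k <= b * b * k)%N by rewrite leq_mul2r h6 orbT.
lia.
Qed.

(** The [k ^ 2] arises from a number of windows linear in [k], each scanning a pool of size linear
    in [k]. *)
Lemma query_arith (A b w k n M : nat) : (0 < k)%N -> (w <= k * b)%N ->
  (2 * A * n + (A * (A * w) + A * (2 * A + 2)) * w
   <= (2 * A + (A * A * b + A * (2 * A + 2)) * b + M) * (n + k ^ 2))%N.
Proof.
move=> k0 wk; rewrite [X in (_ <= X)%N]mulnDr; apply: leq_add; first by rewrite leq_mul2r -addnA leq_addr orbT.
apply: (@leq_trans ((A * A * b + A * (2 * A + 2)) * b * k ^ 2)); last first.
  by rewrite leq_mul2r addnAC leq_addl orbT.
have -> : ((A * A * b + A * (2 * A + 2)) * b * k ^ 2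
  = (A * (A * (k * b)) + A * (2 * A + 2) * k) * (k * b))%N by ring.
apply: leq_mul => //; apply: leq_add; first by rewrite !leq_mul2l wk !orbT.
by rewrite leq_pmulr.
Qed.

Lemma small_query_arith (A X k n M : nat) : (n < k * M)%N ->
  (2 * 1 * n + k * n.+1 <= (2 * A.+1 + X + M) * (n + k ^ 2))%N.
Proof.
move=> nk; rewrite [X in (_ <= X)%N]mulnDr; apply: leq_add; first by rewrite leq_mul2r; lia.
apply: (@leq_trans (M * k ^ 2)); last by rewrite leq_mul2r leq_addl orbT.
by rewrite mulnC (_ : M * k ^ 2 = k * M * k)%N ?leq_mul2r ?nk ?orbT //; ring.
Qed.

(** * Resources and ratio of the full algorithm *)

Section Assembly.
Variables (R : realType) (U : finType) (f : {set U} -> R) (N k : nat).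
Hypotheses (N20 : (20 <= N)%N) (k_gt0 : (0 < k)%N).

Let N_gt0 : (0 < N)%N. Proof. exact: leq_trans N20. Qed.
Let p n := stream_params N n k.

Let size_stream (sigma : {perm U}) : size (stream sigma) = #|U|.
Proof. by rewrite size_map -cardE. Qed.

Let blen_gt0 n : (0 < blen (p n))%N.
Proof. by rewrite /p /stream_params; case: ifP => //= _; rewrite expn_gt0 N_gt0. Qed.

Let small_nwin n : small (p n) -> nwin (p n) = 0%N.
Proof. by rewrite /p /stream_params; case: ifP. Qed.

Let blen_nwin n : (blen (p n) %| nwin (p n))%N.
Proof. by rewrite /p /stream_params; case: ifP => //= _; rewrite dvdn_mull. Qed.

Let blocks_le : (N.-1 * k %/ N ^ 3 * N ^ 2 <= k)%N.
Proof.
rewrite -(@leq_pmul2r N) // -mulnA -expnSr.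
apply: leq_trans (leq_trunc_div _ _) _; by rewrite mulnC leq_mul2l leq_pred orbT.
Qed.

Let nwin_le : (N.-1 * k %/ N ^ 3 * N ^ 4 <= k * N ^ 2)%N.
Proof. by rewrite (_ : 4 = 2 + 2)%N // expnD mulnA leq_mul2r blocks_le orbT. Qed.

Lemma stream_resources (sigma : {perm U}) :
  let o := outcome (window_algorithm R (stream_params N)) f k (stream sigma) in
  [/\ (#|o.1.1| <= k)%N, (o.2 <= 4 * N ^ 7 * k)%N &
      (o.1.2 <= query_constant N * (#|U| + k ^ 2))%N].
Proof.
have := @outcome_simulation R U f (stream_params N) k (stream sigma).
rewrite size_stream -/(p #|U|) => /(_ (blen_gt0 _) (@small_nwin _) (blen_nwin _)).
cbv zeta; case=> _; set o := outcome _ _ _ _.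
rewrite /memory_bound /window_cost /p /stream_params /query_constant.
case: ltnP => /= nk hc hm hq.
  split => //.
    by apply: leq_trans hm _; apply: leq_trans (ltnW nk) _; rewrite mulnC leq_mul2r leq_pmull ?orbT.
  by apply: leq_trans hq _; rewrite muln0 addn0; exact: small_query_arith.
have qd : (N.-1 * k %/ N ^ 3 * N ^ 4 %/ N ^ 4 = N.-1 * k %/ N ^ 3)%N.
  by rewrite mulnK // expn_gt0 N_gt0.
rewrite qd in hc hm.
have b_ge10 : (10 <= N ^ 2)%N.
  by apply: (@leq_trans (20 ^ 2)); rewrite ?leq_exp2r.
have N6 : (N ^ 2 * N ^ 2 * N ^ 2 <= N ^ 7)%N by rewrite -!expnD leq_exp2l // (leq_trans _ N20).
split.
- by apply: leq_trans hc _; rewrite addn0 mulnC.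
- by apply: leq_trans hm _; apply: memory_arith => //; exact: blocks_le.
- by apply: leq_trans hq _; rewrite addn0; apply: query_arith.
Qed.

Hypotheses (f_mono : monotone_fun f) (f_sub : submodular f) (f0 : 0 <= f set0).

Let value_outcome (sigma : {perm U}) :
  f (outcome (window_algorithm R (stream_params N)) f k (stream sigma)).1.1
  = value f (result (value f) (p #|U|)
      (foldl (fun st x => step (value f) (p #|U|) st [:: x])
        (init_state U (p #|U|)) (stream sigma))).
Proof.
have := @outcome_simulation R U f (stream_params N) k (stream sigma).
rewrite size_stream -/(p #|U|) => /(_ (blen_gt0 _) (@small_nwin _) (blen_nwin _)).
by cbv zeta; case=> -> _ _ _.
Qed.

Lemma stream_ratio : (8 * N ^ 2 <= k)%N ->
  (1 - expR (-1) - 6 / N%:R - 2 * N%:R ^+ 2 / k%:R) * OPT f k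
  <= expected_value (window_algorithm R (stream_params N)) f k.
Proof.
move=> kN; rewrite /expected_value.
have [O [_ OE]] := OPT_attained f k.
have O0 : 0 <= OPT f k by rewrite -OE f_ge0.
have P0 : 0 < #|{perm U}|%:R :> R by rewrite ltr0n; apply/card_gt0P; exists 1%g.
under eq_bigr do rewrite value_outcome.
have [nk|nk] := ltnP #|U| (k * N ^ 7).
  rewrite ler_pdivlMr // mulr_natr -sumr_const; apply: ler_sum => sigma _.
  rewrite result_small; last by rewrite /p /stream_params nk.
  rewrite /p /stream_params nk /=.
  apply: le_trans (@greedy_ratio _ _ _ f_mono f_sub f0 (stream sigma) k k_gt0 _).
    rewrite ler_wpM2r //.
    have : 0 <= 6 / N%:R :> R by rewrite divr_ge0 ?ler0n.
    have : 0 <= 2 * N%:R ^+ 2 / k%:R :> R by rewrite divr_ge0 ?mulr_ge0 ?exprn_ge0 ?ler0n.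
    lra.
  by move=> x; apply/mapP; exists (sigma^-1 x)%g; rewrite ?mem_enum ?permKV.
apply: le_trans (large_stream_ratio f_mono f_sub f0 N20 k_gt0 nk kN) _.
apply: ler_wpM2r; first by rewrite invr_ge0 ltW.
apply: ler_sum => sigma _.
have nk' : (#|U| < k * N ^ 7)%N = false by rewrite ltnNge nk.
rewrite result_windows.
- rewrite /p /stream_params nk' /= -nth_last size_window_state /=.
  rewrite le_eqVlt; apply/orP; left; apply/eqP; congr (value f (nth [::] _.2 _)).
  by apply: eq_window_state => j _; rewrite /stream map_take map_drop.
- by rewrite /p /stream_params nk'.
- rewrite /p /stream_params nk' /= divn_gt0 ?muln_gt0 ?k_gt0 ?expn_gt0 ?N_gt0 //.
  by apply: leq_trans nk; rewrite leq_mul2l leq_exp2l ?orbT // (leq_trans _ N20).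
- rewrite size_stream /p /stream_params nk' /=.
  apply: leq_trans (leq_mul nwin_le (leqnn _)) _.
  by have := leq_trunc_div #|U| (k * N ^ 2); rewrite mulnC.
- by rewrite /p /stream_params nk'.
Qed.

End Assembly.

Theorem theorem2 (R : realType) :
  exists (c : R) (d : nat), 0 < c /\
  forall eps : R, 0 < eps < 1 ->
  exists (Alg : algorithm R) (eta : nat -> nat) (C : R),
    (forall k : nat, (0 < k)%N ->
       (eta k)%:R <= c * expR (c * eps ^- d) * k%:R) /\
    (forall (U : finType) (k : nat) (f : {set U} -> R),
       (0 < k)%N -> monotone_fun f -> submodular f -> 0 <= f set0 ->
       (forall sigma : {perm U},
          let o := outcome Alg f k (stream sigma) in
          [/\ (#|o.1.1| <= k)%N,
              (o.2 <= eta k)%N &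
              (o.1.2)%:R <= C * (#|U| + k ^ 2)%:R]) /\
       (1 - expR (-1) - eps - C / k%:R) * OPT f k
         <= expected_value Alg f k).
Proof.
(* The buffer has size [4 * N ^ 7 * k] with [N <= 21 / eps <= expR (21 / eps)], whence
   [147 = 7 * 21], which also exceeds the factor 4. *)
exists 147, 1%N; split => // eps /andP[e0 e1].
(* As [eps < 1], this gives [N >= 20], and it makes [6 / N] smaller than [eps]. *)
pose N := (Num.truncn (20 / eps)).+1.
have [Nlo Nhi] : 20 / eps < N%:R /\ N%:R <= 21 / eps.
  have := truncn_itv (ltW (divr_gt0 (ltr0n R 20) e0)) => /andP[h1 h2]; split => //.
  have e1' : 1 <= 1 / eps by rewrite ler_pdivlMr // mul1r ltW.
  by rewrite /N -[leLHS]natr1; lra.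
have N20 : (20 <= N)%N.
  rewrite -(ler_nat R); apply/ltW/(le_lt_trans _ Nlo).
  by rewrite ler_pdivlMr //; lra.
have NR0 : 0 < N%:R :> R by rewrite ltr0n.
(* [C] serves three times: it bounds the queries, dominates the [2 N ^ 2] of the ratio, and exceeds
   [k] whenever [k < 8 N ^ 2]. *)
exists (window_algorithm R (stream_params N)), (fun k => 4 * N ^ 7 * k)%N,
  (query_constant N + 8 * N ^ 2)%:R.
split=> [k k0|U k f k0 fm fs f0].
  rewrite natrM ler_wpM2r ?ler0n // natrM natrX expr1.
  have : N%:R ^+ 7 <= expR (147 / eps) :> R.
    have -> : 147 / eps = 7%:R * (21 / eps) by ring.
    rewrite expRM_natl; apply: lerXn2r; rewrite ?nnegrE ?expR_ge0 ?ler0n //.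
    by apply: le_trans Nhi _; apply: le_trans (expR_ge1Dx _); rewrite lerDr.
  have := expR_ge0 (147 / eps); lra.
split=> [sigma|].
  have [h1 h2 h3] := stream_resources f N20 k0 sigma; split => //.
  by rewrite -natrM ler_nat (leq_trans h3) // leq_mul2r leq_addr orbT.
have [O [_ OE]] := OPT_attained f k.
have O0 : 0 <= OPT f k by rewrite -OE f_ge0.
have kR : 0 < k%:R :> R by rewrite ltr0n.
(* For small [k] the error [C / k] is at least 1, so the claimed bound is at most 0 and
   nonnegativity of [f] suffices. *)
have [kN|kN] := ltnP k (8 * N ^ 2).
  apply: (@le_trans _ _ 0); last first.
    by rewrite divr_ge0 ?ler0n //; apply: sumr_ge0 => sigma _; exact: f_ge0.
  rewrite mulr_le0_ge0 //.
  have : 1 <= (query_constant N + 8 * N ^ 2)%:R / k%:R :> R.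
    by rewrite ler_pdivlMr // mul1r ler_nat; lia.
  have := expR_ge0 (-1 : R); lra.
apply: le_trans (stream_ratio N20 k0 fm fs f0 kN); rewrite ler_wpM2r //.
have : 6 / N%:R <= eps.
  rewrite ler_pdivrMr // mulrC; move: Nlo; rewrite ltr_pdivrMr // => h.
  by apply: le_trans (ltW h); lra.
have : 2 * N%:R ^+ 2 / k%:R <= (query_constant N + 8 * N ^ 2)%:R / k%:R :> R.
  by rewrite ler_wpM2r ?invr_ge0 ?ler0n // -natrX -natrM ler_nat; lia.
lra.
Qed.
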